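(* Let $m\ge 3$ be an integer, let $\rho>0$ and $t>0$ be fixed. For $c>0$, $\lambda>0$ let $\mathbf X(t)=(X_1(t),\dots,X_m(t))$ be the $m$-dimensional symmetric Markov random flight with speed $c$ and switching intensity $\lambda$, and let $\mu_{(2,2,0,\dots,0)}(t)=\mathbb E\left[X_1(t)^2X_2(t)^2\right]$ (which depends on $c$ and $\lambda$). Then, under the Kac scaling condition $c\to\infty$, $\lambda\to\infty$, $c^2/\lambda\to\rho$, $$\lim_{\substack{c,\lambda\to\infty\\ c^2/\lambda\to\rho}}\mu_{(2,2,0,\dots,0)}(t)=\left(\frac{2\rho t}{m}\right)^2,$$ which is the product of the variances at time $t$ of two coordinates of the $m$-dimensional homogeneous Brownian motion with zero drift and diffusion coefficient $\sigma^2=2\rho/m$ (each coordinate having variance $\sigma^2t$ at time $t$).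
   Context: The $m$-dimensional symmetric Markov random flight with speed $c>0$ and switching intensity $\lambda>0$ is the following process. A particle starts at the origin of $\mathbb R^m$ at time $0$ and moves with constant speed $c$. Let $0=\tau_0<\tau_1<\tau_2<\dots$, where $\tau_1,\tau_2,\dots$ are the jump times of a homogeneous Poisson process $N(t)$ of rate $\lambda$, and let $U_0,U_1,U_2,\dots$ be independent random vectors, independent of the Poisson process, each uniformly distributed on the unit sphere $\{\mathbf x\in\mathbb R^m:\|\mathbf x\|=1\}$. The particle moves in direction $U_j$ during the time interval $[\tau_j,\tau_{j+1})$, so that its position at time $t$ is $$\mathbf X(t)=c\sum_{j=0}^{N(t)-1}(\tau_{j+1}-\tau_j)U_j+c\,(t-\tau_{N(t)})U_{N(t)}.$$ The limit means: for all sequences $c_n\to\infty$, $\lambda_n\to\infty$ with $c_n^2/\lambda_n\to\rho$, the corresponding moments at the fixed time $t$ converge to the stated value. *)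

(* Defs.v *)
From HB Require Import structures.
From mathcomp Require Import all_boot all_order all_algebra finmap.
From mathcomp Require Import all_classical all_reals all_analysis.

Set Implicit Arguments.
Unset Strict Implicit.
Unset Printing Implicit Defensive.

Import Order.TTheory GRing.Theory Num.Theory.
Import numFieldNormedType.Exports.

Local Open Scope classical_set_scope.
Local Open Scope ring_scope.

Section Independence.
Context d (T : measurableType d) (R : realType) (P : probability T R).

Definition mutually_independent (I : choiceType) (F : I -> set (set T)) :=
  forall (J : {fset I}) (E : I -> set T),
    (forall i, i \in J -> F i (E i)) ->
    P (\bigcap_(i in [set` J]) E i) = (\prod_(i <- J) P (E i))%E.

Definition independent_pair (F G : set (set T)) :=
  forall A B, F A -> G B -> P (A `&` B) = (P A * P B)%E.

Definition sigma_rv d' (T' : measurableType d') (X : T -> T') : set (set T) :=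
  preimage_set_system setT X measurable.

Definition sigma_process (I : Type) (D : set I) d' (T' : measurableType d')
    (X : I -> T -> T') : set (set T) :=
  <<s \bigcup_(i in D) sigma_rv (X i) >>.

Definition independent_rvs (I : choiceType) d' (T' : measurableType d')
    (X : I -> T -> T') :=
  mutually_independent (fun i => sigma_rv (X i)).

End Independence.

Section Sphere.
Context (R : realType).

Definition enorm n (x : n.-tuple R) : R :=
  Num.sqrt (\sum_(i < n) tnth x i ^+ 2).

(* n-dimensional Lebesgue measure, as the n-fold iterated integral *)
Fixpoint volume n : set (n.-tuple R) -> \bar R :=
  match n with
  | 0 => fun A => \d_([tuple] : 0.-tuple R) A
  | n'.+1 => fun A =>
      (\int[lebesgue_measure]_x
         volume [set v : n'.-tuple R | A [tuple of x :: v]])%E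
  end.

(* The part of the punctured unit ball lying over the set A of directions;
   the normalised surface measure of A is the proportion of volume it takes. *)
Definition ball_sector n (A : set (n.-tuple R)) : set (n.-tuple R) :=
  [set x | 0 < enorm x <= 1 /\ A [tuple tnth x i / enorm x | i < n]].

Definition sphere_uniform n (A : set (n.-tuple R)) : R :=
  fine (volume (ball_sector A)) / fine (volume (ball_sector (n := n) setT)).

End Sphere.

Section Processes.
Context d (T : measurableType d) (R : realType) (P : probability T R).

Record poisson_process (lambda : R) (N : R -> T -> nat) : Prop := {
  poisson_measurable : forall t, 0 <= t -> measurable_fun setT (N t);
  poisson_start : forall w, N 0 w = 0%N;
  poisson_nondecreasing : forall w s t, 0 <= s <= t -> (N s w <= N t w)%N;
  poisson_right_continuous : forall w s, 0 <= s ->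
    N u w @[u --> s^'+] --> N s w;
  poisson_independent_increments : forall s : nat -> R,
    0 <= s 0%N -> nondecreasing_seq s ->
    independent_rvs P (fun k w => (N (s k.+1) w - N (s k) w)%N);
  poisson_increments : forall s t, 0 <= s < t -> forall k,
    P [set w | (N t w - N s w)%N = k] = (poisson_pmf (lambda * (t - s)) k)%:E
}.

(* tau_k, with tau_0 = 0. When N never reaches k the infimum is that of the
   empty set; flight only uses tau_k for k <= N t. *)
Definition jump_time (N : R -> T -> nat) (k : nat) (w : T) : R :=
  inf [set s | 0 <= s /\ (k <= N s w)%N].

Record flight_driver m (lambda : R) (N : R -> T -> nat)
    (U : nat -> T -> m.-tuple R) : Prop := {
  flight_switching : poisson_process lambda N;
  flight_direction_measurable : forall j, measurable_fun setT (U j);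
  flight_direction_uniform : forall j A, measurable A ->
    P (U j @^-1` A) = (sphere_uniform A)%:E;
  flight_directions_independent : independent_rvs P U;
  flight_independent :
    independent_pair P (sigma_process [set: nat] U)
                       (sigma_process [set s : R | 0 <= s] N)
}.

Definition flight m (c : R) (N : R -> T -> nat) (U : nat -> T -> m.-tuple R)
    (t : R) (w : T) : m.-tuple R :=
  [tuple c * (\sum_(0 <= j < N t w)
                (jump_time N j.+1 w - jump_time N j w) * tnth (U j w) i)
         + c * (t - jump_time N (N t w) w) * tnth (U (N t w) w) i | i < m].

Record brownian_motion m (sigma2 : R) (B : R -> T -> m.-tuple R) : Prop := {
  brownian_measurable : forall t, 0 <= t -> measurable_fun setT (B t);
  brownian_start : forall w i, tnth (B 0 w) i = 0;
  brownian_continuous : forall w i,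
    {within `[0, +oo[, continuous (fun s => tnth (B s w) i)};
  brownian_independent_increments : forall s : nat -> R,
    0 <= s 0%N -> nondecreasing_seq s ->
    independent_rvs P
      (fun k w => [tuple tnth (B (s k.+1) w) i - tnth (B (s k) w) i | i < m]);
  brownian_independent_coordinates : forall s t, 0 <= s < t ->
    independent_rvs P (fun (i : 'I_m) w => tnth (B t w) i - tnth (B s w) i);
  (* the second parameter of normal_prob is the standard deviation *)
  brownian_increments : forall s t, 0 <= s < t -> forall i A, measurable A ->
    P [set w | A (tnth (B t w) i - tnth (B s w) i)]
      = normal_prob 0 (Num.sqrt (sigma2 * (t - s))) A
}.

End Processes.

(* Main.v *)
Require Import Defs.
From HB Require Import structures.
From mathcomp Require Import all_boot all_order all_algebra finmap.
From mathcomp Require Import all_classical all_reals all_analysis.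
From mathcomp Require Import measurable_realfun ring lra.

Set Implicit Arguments.
Unset Strict Implicit.
Unset Printing Implicit Defensive.

Import Order.TTheory GRing.Theory Num.Theory.
Import numFieldNormedType.Exports.

Local Open Scope classical_set_scope.
Local Open Scope ring_scope.

(** The displacement is c times the time integral of the velocity, and the
    velocity at time s is U (N s). Expanding the product of the four coordinates
    writes the moment as a fourfold integral over times s1, s2 (first
    coordinate) and s3, s4 (second coordinate) of the expectation of four
    coordinates of directions.

    Symmetry of the sphere decides that expectation once N is known
    (four_directions): reflecting a coordinate kills every term in which some
    direction carries an odd number of factors of one coordinate, and exchanging
    coordinates gives each squared coordinate the mean 1/m. So a term survives
    only if N s1 = N s2 and N s3 = N s4, with value 1/m^2, or a bounded value if
    all four agree. The two coincidences have probabilities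
    exp (- lambda |s1 - s2|) and exp (- lambda |s3 - s4|), and they are
    independent unless the two time intervals meet, in which case everything is
    at most exp (- lambda D) with D the spread of the four times
    (no_switch_decorrelation, four_times_decay).

    The product of the two exponentials integrates to the square of
    2 t / lambda + O(1 / lambda^2), while the correlated part is
    O(t / lambda^3): four times within a few mean holding times of each other
    have only one free parameter (path_moment_close). Multiplied by c^4, the
    main term tends to (2 rho t / m)^2 and the rest is (c^2 / lambda)^2 times
    O(1 / lambda) (kac_limit).

    The integrals over times are replaced by sums over the grid of mesh t / K.
    For a fixed trajectory these Riemann sums converge to the displacement
    (riemann_sum_error), dominated convergence carries the moments along
    (path_moment_cvg), and on the grid everything reduces to finite geometric
    sums (geometric_squareE, geometric_row_le).

    The variance of a Brownian coordinate is the second moment of a centred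
    normal law, obtained by integration by parts (normal_second_moment). *)

(** * Bounded random variables *)

Lemma measurable_set_ltr d (T : measurableType d) (R : realType) (f g : T -> R) :
  measurable_fun setT f -> measurable_fun setT g ->
  measurable [set x | f x < g x].
Proof.
move=> mf mg; rewrite -[X in measurable X]setTI.
exact: (measurable_fun_ltr mf mg measurableT (Y := [set true])).
Qed.

Section BoundedMeasurable.
Context d (T : measurableType d) (R : realType).
Implicit Types f g : T -> R.

Definition bounded_measurable f :=
  measurable_fun setT f /\ exists M : R, forall x, `|f x| <= M.

Lemma bounded_measurable_cst (r : R) : bounded_measurable (fun _ => r).
Proof. by split; [exact: measurable_cst | exists `|r|]. Qed.

Lemma bounded_measurableD f g : bounded_measurable f -> bounded_measurable g ->
  bounded_measurable (fun x => f x + g x).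
Proof.
move=> [mf [M fM]] [mg [K gK]]; split; first exact: measurable_funD.
by exists (M + K) => x; apply: (le_trans (ler_normD _ _)); exact: lerD.
Qed.

Lemma bounded_measurableM f g : bounded_measurable f -> bounded_measurable g ->
  bounded_measurable (fun x => f x * g x).
Proof.
move=> [mf [M fM]] [mg [K gK]]; split; first exact: measurable_funM.
by exists (M * K) => x; rewrite normrM ler_pM.
Qed.

Lemma bounded_measurableZ (r : R) f : bounded_measurable f ->
  bounded_measurable (fun x => r * f x).
Proof. by apply: bounded_measurableM; exact: bounded_measurable_cst. Qed.

Lemma bounded_measurableB f g : bounded_measurable f -> bounded_measurable g ->
  bounded_measurable (fun x => f x - g x).
Proof.
move=> bf bg; apply: bounded_measurableD => //.
under [X in bounded_measurable X]eq_fun do rewrite -mulN1r.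
exact: bounded_measurableZ.
Qed.

Lemma bounded_measurable_sum I (s : seq I) (F : I -> T -> R) :
  (forall i, bounded_measurable (F i)) ->
  bounded_measurable (fun x => \sum_(i <- s) F i x).
Proof.
move=> bF; elim: s => [|i s IHs].
  under [X in bounded_measurable X]eq_fun do rewrite big_nil.
  exact: bounded_measurable_cst.
under [X in bounded_measurable X]eq_fun do rewrite big_cons.
exact: bounded_measurableD.
Qed.

Lemma bounded_measurable_prod I (s : seq I) (F : I -> T -> R) :
  (forall i, bounded_measurable (F i)) ->
  bounded_measurable (fun x => \prod_(i <- s) F i x).
Proof.
move=> bF; elim: s => [|i s IHs].
  under [X in bounded_measurable X]eq_fun do rewrite big_nil.
  exact: bounded_measurable_cst.
under [X in bounded_measurable X]eq_fun do rewrite big_cons.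
exact: bounded_measurableM.
Qed.

Lemma bounded_measurable_indic (A : set T) : measurable A ->
  bounded_measurable (\1_A : T -> R).
Proof.
move=> mA; split; first exact: measurable_indic.
by exists 1 => x; rewrite indicE; case: (_ \in _); rewrite ?normr1 ?normr0.
Qed.

Lemma bounded_measurable_comp d' (T' : measurableType d') (h : T' -> R)
    (V : T -> T') :
  measurable_fun setT h -> (exists M, forall x, `|h x| <= M) ->
  measurable_fun setT V -> bounded_measurable (fun x => h (V x)).
Proof.
move=> mh [M hM] mV; split; last by exists M => x; exact: hM.
exact: (measurableT_comp mh mV).
Qed.

End BoundedMeasurable.

Section Expectation.
Context d (T : measurableType d) (R : realType) (P : probability T R).
Implicit Types f g W Z : T -> R.

Lemma bounded_integrable f : bounded_measurable f ->
  P.-integrable setT (EFin \o f).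
Proof.
move=> [mf [M fM]]; apply: measurable_bounded_integrable => //.
  by rewrite /= probability_setT ltry.
exists M; split; first exact: num_real.
by move=> x Mx t _ /=; apply: (le_trans (fM t)); exact: ltW.
Qed.

Lemma expectD f g : bounded_measurable f -> bounded_measurable g ->
  \int[P]_x (f x + g x) = \int[P]_x f x + \int[P]_x g x.
Proof. by move=> bf bg; rewrite RintegralD//; exact: bounded_integrable. Qed.

Lemma expectB f g : bounded_measurable f -> bounded_measurable g ->
  \int[P]_x (f x - g x) = \int[P]_x f x - \int[P]_x g x.
Proof. by move=> bf bg; rewrite RintegralB//; exact: bounded_integrable. Qed.

Lemma expectZ (r : R) f : bounded_measurable f ->
  \int[P]_x (r * f x) = r * \int[P]_x f x.
Proof. by move=> bf; rewrite RintegralZl//; exact: bounded_integrable. Qed.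

Lemma expect_cst (r : R) : \int[P]_x r = r.
Proof. by rewrite Rintegral_cst//= probability_setT mulr1. Qed.

Lemma expect_sum I (s : seq I) (F : I -> T -> R) :
  (forall i, bounded_measurable (F i)) ->
  \int[P]_x (\sum_(i <- s) F i x) = \sum_(i <- s) \int[P]_x F i x.
Proof.
move=> bF; elim: s => [|i s IHs].
  by under eq_Rintegral do rewrite big_nil; rewrite big_nil expect_cst.
under eq_Rintegral do rewrite big_cons.
by rewrite big_cons expectD ?IHs//; exact: bounded_measurable_sum.
Qed.

Lemma expect_indic (A : set T) : measurable A ->
  \int[P]_x \1_A x = fine (P A).
Proof. by move=> mA; rewrite /Rintegral integral_indic// setIT. Qed.

Lemma le_expect f g : bounded_measurable f -> bounded_measurable g ->
  (forall x, f x <= g x) -> \int[P]_x f x <= \int[P]_x g x.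
Proof. by move=> bf bg fg; apply: le_Rintegral => //; exact: bounded_integrable. Qed.

Lemma norm_expect_le f (M : R) : bounded_measurable f ->
  (forall x, `|f x| <= M) -> `|\int[P]_x f x| <= M.
Proof.
move=> bf fM; apply: (le_trans (le_normr_Rintegral _ _)) => //.
  exact: bounded_integrable.
rewrite -[leRHS]expect_cst; apply: le_expect => //.
  case: bf => mf [K fK]; split; first exact: measurableT_comp.
  by exists K => x; rewrite normr_id.
exact: bounded_measurable_cst.
Qed.

Lemma expect_ae_eq f g : measurable_fun setT f -> measurable_fun setT g ->
  {ae P, forall x, f x = g x} -> \int[P]_x f x = \int[P]_x g x.
Proof.
move=> mf mg fg; congr fine; apply: ae_eq_integral => //.
- exact/measurable_EFinP.
- exact/measurable_EFinP.
- by apply: filterS fg => x /= -> _.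
Qed.

Lemma expect_same_law d' (T' : measurableType d') (V W : T -> T') (h : T' -> R) :
  measurable_fun setT V -> measurable_fun setT W -> measurable_fun setT h ->
  (exists M, forall y, `|h y| <= M) ->
  (forall A, measurable A -> P (V @^-1` A) = P (W @^-1` A)) ->
  \int[P]_x h (V x) = \int[P]_x h (W x).
Proof.
move=> mV mW mh bh VW.
have ih X : measurable_fun setT X -> P.-integrable setT (EFin \o h \o X).
  by move=> mX; apply: bounded_integrable; exact: bounded_measurable_comp.
have mEh : measurable_fun setT (EFin \o h) by exact/measurable_EFinP.
congr fine.
have pE X : measurable_fun setT X ->
    (\int[P]_x (h (X x))%:E = \int[pushforward P X]_y (h y)%:E)%E.
  move=> mX.
  rewrite (@integral_pushforward _ _ _ _ _ _ mX _ setT (EFin \o h) mEh)//.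
  exact: ih.
rewrite !pE//; apply: eq_measure_integral => A mA _; exact: VW.
Qed.

End Expectation.

Section Counting.
Context (R : realType).

(** The number of naturals below x is within 1 of x. This serves both to
    discretize the range of a random variable and to estimate Riemann sums. *)
Lemma count_below (K : nat) (x : R) : 0 <= x <= K%:R ->
  `|\sum_(0 <= k < K) ((k%:R < x)%R%:R : R) - x| <= 1.
Proof.
elim: K => [|K IHK] /andP[x0 xK].
  by rewrite big_geq// (_ : x = 0) ?subrr ?normr0//; apply/le_anti/andP.
rewrite big_nat_recr//=; case: (lerP x K%:R) => [xK'|Kx].
  by rewrite addr0 IHK// x0.
rewrite (eq_big_nat _ _ (F2 := fun=> 1)); last first.
  move=> k /andP[_ kK].
  by rewrite (_ : k%:R < x) ?(le_lt_trans _ Kx)// ler_nat ltnW.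
rewrite big_const_nat subn0 iter_addr_0 (_ : true%:R = 1)//.
move: xK; rewrite -natr1 => xK.
rewrite ler_norml; apply/andP; split; lra.
Qed.

End Counting.

Section Factorization.
Context d (T : measurableType d) (R : realType) (P : probability T R).
Implicit Types f g W Z : T -> R.

(** The number of naturals k below n (Z + M) is a sum of indicators of events
    of Z, each orthogonal to W, and is within 1 of n (Z + M). Hence n times the
    expectation of W Z is bounded in n. *)
Lemma orthogonal_comp W Z : bounded_measurable W -> bounded_measurable Z ->
  (forall A, measurable A -> \int[P]_x (W x * \1_(Z @^-1` A) x) = 0) ->
  \int[P]_x (W x * Z x) = 0.
Proof.
move=> bW bZ WZ.
have mZA A : measurable A -> measurable (Z @^-1` A).
  by move=> mA; rewrite -[X in measurable X]setTI; exact: bZ.1.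
have [_ [M0 ZM0]] := bZ; have [_ [L WL]] := bW.
have L0 : 0 <= L by apply: le_trans (WL point).
pose M := (Num.truncn `|M0|).+1.
have ZM x : `|Z x| <= M%:R.
  apply: (le_trans (ZM0 x)); apply: (le_trans (ler_norm _)).
  by rewrite ltW// truncnS_gt.
pose I f := \int[P]_x (W x * f x).
have I1 : \int[P]_x W x = 0.
  rewrite -(WZ _ measurableT); apply: eq_Rintegral => x _.
  by rewrite preimage_setT indicE in_setT mulr1.
suff key n : `|I Z| * n%:R <= L.
  apply/eqP; rewrite -normr_eq0; apply/negPn/negP => IZ0.
  have IZp : 0 < `|I Z| by rewrite lt_def IZ0 normr_ge0.
  have := key (Num.truncn (L / `|I Z|)).+1.
  apply/negP; rewrite -ltNge mulrC -ltr_pdivrMr//.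
  exact: truncnS_gt.
pose B k := [set z : R | k%:R < n%:R * (z + M%:R)].
have mB k : measurable (B k).
  apply: measurable_set_ltr => //; apply: measurable_funM => //.
  exact: measurable_funD.
have BE k x : \1_(Z @^-1` B k) x = (k%:R < n%:R * (Z x + M%:R))%R%:R :> R.
  rewrite indicE; congr (_%:R); congr nat_of_bool.
  by apply/idP/idP; rewrite in_setE.
pose S x : R := \sum_(0 <= k < (n * (M + M))%N) \1_(Z @^-1` B k) x.
have bB k : bounded_measurable (\1_(Z @^-1` B k) : T -> R).
  by apply: bounded_measurable_indic; exact: mZA.
have bS : bounded_measurable S by exact: bounded_measurable_sum.
have IS : I S = 0.
  rewrite /I /S; under eq_Rintegral do rewrite mulr_sumr.
  rewrite expect_sum; last by move=> k; exact: bounded_measurableM.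
  by rewrite big1_seq// => k _; exact: WZ.
have -> : `|I Z| * n%:R = `|\int[P]_x (W x * (n%:R * (Z x + M%:R) - S x))|.
  rewrite -[n%:R in LHS]ger0_norm// -normrM; congr `|_|.
  transitivity (n%:R * I Z + (n%:R * M%:R) * (\int[P]_x W x) - I S).
    by rewrite I1 IS mulr0 subr0 addr0 mulrC.
  rewrite -expectZ//; last exact: bounded_measurableM.
  rewrite -expectZ// -expectD; [| |exact: bounded_measurableZ]; last first.
    exact: bounded_measurableZ (bounded_measurableM _ _).
  rewrite -expectB; [| |exact: bounded_measurableM]; last first.
    apply: bounded_measurableD; last exact: bounded_measurableZ.
    exact: bounded_measurableZ (bounded_measurableM _ _).
  by apply: eq_Rintegral => x _; ring.
apply: norm_expect_le.
  apply: bounded_measurableM => //; apply: bounded_measurableB => //.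
  apply: bounded_measurableZ; apply: bounded_measurableD => //.
  exact: bounded_measurable_cst.
move=> x; rewrite normrM -[leRHS]mulr1 ler_pM// distrC /S.
under eq_bigr do rewrite BE.
apply: count_below; have := ZM x; rewrite ler_norml => /andP[ZM1 ZM2].
rewrite mulr_ge0//=; last by lra.
by rewrite natrM ler_wpM2l// natrD; lra.
Qed.

(** This is the orthogonality above for the centred weight W - C. *)
Lemma factorization d' (T' : measurableType d') W (V : T -> T') (C : R)
    (h : T' -> R) :
  bounded_measurable W -> measurable_fun setT V ->
  measurable_fun setT h -> (exists M, forall y, `|h y| <= M) ->
  (forall A, measurable A ->
     \int[P]_x (W x * \1_(V @^-1` A) x) = C * fine (P (V @^-1` A))) ->
  \int[P]_x (W x * h (V x)) = C * \int[P]_x h (V x).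
Proof.
move=> bW mV mh bh WV.
have bhV := bounded_measurable_comp mh bh mV.
have bC := @bounded_measurable_cst _ T R C.
have mVA A : measurable A -> measurable (V @^-1` A).
  by move=> mA; rewrite -[X in measurable X]setTI; exact: mV.
apply/eqP; rewrite -subr_eq0 -expectZ// -expectB//; last 2 first.
- exact: bounded_measurableM.
- exact: bounded_measurableZ.
apply/eqP; under eq_Rintegral do rewrite -mulrBl.
apply: (orthogonal_comp (W := fun x => W x - C)) => //.
  exact: bounded_measurableB.
move=> A mA.
have mhA : measurable (h @^-1` A).
  by rewrite -[X in measurable X]setTI; exact: mh.
have b1 : bounded_measurable (\1_(V @^-1` (h @^-1` A)) : T -> R).
  by apply: bounded_measurable_indic; exact: mVA.
transitivity (\int[P]_x (W x * \1_(V @^-1` (h @^-1` A)) x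
                        - C * \1_(V @^-1` (h @^-1` A)) x)).
  by apply: eq_Rintegral => x _; rewrite mulrBl.
rewrite expectB; [|exact: bounded_measurableM|exact: bounded_measurableZ].
by rewrite expectZ// expect_indic ?WV ?subrr//; exact: mVA.
Qed.

Lemma expect_partition (Y : T -> nat) f g :
  (forall n, measurable (Y @^-1` [set n])) ->
  bounded_measurable f -> bounded_measurable g ->
  (forall n, \int[P]_x (f x * \1_(Y @^-1` [set n]) x)
           = \int[P]_x (g x * \1_(Y @^-1` [set n]) x)) ->
  \int[P]_x f x = \int[P]_x g x.
Proof.
move=> mY bf bg fg.
have UY : \bigcup_n (Y @^-1` [set n]) = setT.
  by apply/seteqP; split => // x _; exists (Y x).
have tY : trivIset setT (fun n => Y @^-1` [set n]).
  apply/trivIsetP => k l _ _ kl; apply/seteqP; split => // x /= [->] /eqP.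
  by rewrite (negbTE kl).
have split_ k : bounded_measurable k -> \int[P]_x k x =
    fine (\sum_(n <oo) \int[P]_(x in Y @^-1` [set n]) (k x)%:E)%E.
  move=> bk; rewrite /Rintegral -UY integral_bigcup//.
  by rewrite UY; exact: bounded_integrable.
have cell k n : bounded_measurable k ->
  (\int[P]_(x in Y @^-1` [set n]) (k x)%:E)%E =
  (\int[P]_x (k x * \1_(Y @^-1` [set n]) x))%:E.
  move=> bk; rewrite /Rintegral fineK.
    rewrite [LHS]integral_mkcond; apply: eq_integral => x _.
    by rewrite patchE indicE; case: ifP => _; rewrite ?mulr1 ?mulr0.
  apply: integrable_fin_num => //; apply: bounded_integrable.
  by apply: bounded_measurableM => //; exact: bounded_measurable_indic.
rewrite !split_//; congr fine; apply: eq_eseriesr => n _.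
by rewrite !cell// fg.
Qed.

End Factorization.

(** * The uniform law on the sphere *)

Section Volume.
Context (R : realType).

Lemma volume_ge0 n (A : set (n.-tuple R)) : (0 <= volume A)%E.
Proof.
elim: n A => [|n IHn] A /=; first exact: measure_ge0.
by apply: integral_ge0 => x _; exact: IHn.
Qed.

(** The parameter space Y is arbitrary so that the induction on the dimension
    can move an integrated coordinate into it. *)
Lemma measurable_volume n d (Y : measurableType d) (B : set (Y * n.-tuple R)) :
  measurable B -> measurable_fun setT (fun y => volume [set v | B (y, v)]).
Proof.
elim: n d Y B => [|n IHn] d Y B mB /=.
  rewrite (_ : (fun y => _) =
      EFin \o \1_((fun y : Y => (y, [tuple] : 0.-tuple R)) @^-1` B)).
    apply/measurable_EFinP; apply: measurable_indic.
    by rewrite -[X in measurable X]setTI; apply: pair2_measurable.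
  by apply/funext => y /=; rewrite diracE indicE.
pose f (p : Y * measurableTypeR R) :=
  volume [set v : n.-tuple R | B (p.1, [tuple of p.2 :: v])].
apply: (@measurable_fun_fubini_tonelli_F _ _ _ _ R lebesgue_measure f); last first.
  by move=> p; exact: volume_ge0.
pose B' : set ((Y * measurableTypeR R) * n.-tuple R) :=
  [set q : (Y * measurableTypeR R) * n.-tuple R |
     B (q.1.1, [tuple of q.1.2 :: q.2])].
have -> : f = fun p => volume [set v | B' (p, v)] by [].
apply: IHn.
rewrite -[X in measurable X]setTI.
apply: (_ : measurable_fun setT
  (fun q : (Y * measurableTypeR R) * n.-tuple R =>
     (q.1.1, [tuple of q.1.2 :: q.2]))) => //.
apply/measurable_fun_pair => /=.
  by apply: measurableT_comp => //; exact: measurable_fst.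
apply: measurable_cons => //.
by apply: measurableT_comp => //; exact: measurable_snd.
Qed.

Lemma measurable_consl n (x : R) (A : set (n.+1.-tuple R)) : measurable A ->
  measurable [set v : n.-tuple R | A [tuple of x :: v]].
Proof.
move=> mA; rewrite -[X in measurable X]setTI.
apply: (_ : measurable_fun setT (fun v : n.-tuple R => [tuple of x :: v])) => //.
exact: measurable_cons.
Qed.

Lemma measurable_thead n : measurable_fun setT (@thead n R).
Proof. exact: measurable_tnth. Qed.

(** A map of this kind commutes with the radial projection, hence preserves the
    uniform law on the sphere. *)
Record ball_symmetry n (g : n.-tuple R -> n.-tuple R) : Prop := {
  symmetry_measurable : measurable_fun setT g;
  symmetry_volume : forall A, measurable A -> volume (g @^-1` A) = volume A;
  symmetry_norm : forall x,
    \sum_(i < n) tnth (g x) i ^+ 2 = \sum_(i < n) tnth x i ^+ 2;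
  symmetry_scale : forall x r,
    g [tuple tnth x i / r | i < n] = [tuple tnth (g x) i / r | i < n] }.

Lemma ball_symmetry_id n : ball_symmetry (@id (n.-tuple R)).
Proof. by split => //; exact: measurable_id. Qed.

Lemma ball_symmetry_comp n (f g : n.-tuple R -> n.-tuple R) :
  ball_symmetry f -> ball_symmetry g -> ball_symmetry (f \o g).
Proof.
move=> [mf vf nf sf] [mg vg ng sg]; split.
- exact: measurableT_comp.
- move=> A mA; rewrite comp_preimage vg ?vf//.
  by rewrite -[X in measurable X]setTI; exact: mf.
- by move=> x /=; rewrite nf ng.
- by move=> x r /=; rewrite sg sf.
Qed.

Definition cons_map n (g : n.-tuple R -> n.-tuple R) (x : n.+1.-tuple R) :
  n.+1.-tuple R := [tuple of thead x :: g [tuple of behead x]].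

Definition swap_head n (x : n.+2.-tuple R) : n.+2.-tuple R :=
  [tuple of thead [tuple of behead x]
            :: thead x :: [tuple of behead [tuple of behead x]]].

Definition neg_head n (x : n.+1.-tuple R) : n.+1.-tuple R :=
  [tuple of - thead x :: [tuple of behead x]].

Lemma behead_cons n (x : R) (v : n.-tuple R) :
  [tuple of behead [tuple of x :: v]] = v.
Proof. exact: val_inj. Qed.

Lemma scale_cons n (x r : R) (v : n.-tuple R) :
  [tuple tnth [tuple of x :: v] i / r | i < n.+1]
  = [tuple of x / r :: [tuple tnth v i / r | i < n]].
Proof.
apply: eq_from_tnth => i; rewrite tnth_mktuple.
by case: (unliftP ord0 i) => [j|] ->; rewrite ?tnth0 ?tnthS ?tnth_mktuple.
Qed.

Lemma sum_cons n (x : R) (v : n.-tuple R) :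
  \sum_(i < n.+1) tnth [tuple of x :: v] i ^+ 2
  = x ^+ 2 + \sum_(i < n) tnth v i ^+ 2.
Proof.
rewrite big_ord_recl tnth0; congr (_ + _).
by apply: eq_bigr => i _; rewrite tnthS.
Qed.

Lemma ball_symmetry_cons n (g : n.-tuple R -> n.-tuple R) :
  ball_symmetry g -> ball_symmetry (cons_map g).
Proof.
move=> [mg vg ng sg]; split.
- apply: measurable_cons; first exact: measurable_thead.
  by apply: measurableT_comp => //; exact: measurable_behead.
- move=> A mA /=; apply: eq_integral => x _.
  rewrite -[RHS]vg; last exact: measurable_consl.
  by congr volume; apply/funext => v /=; rewrite /cons_map behead_cons theadE.
- move=> x; case/tupleP: x => x v.
  by rewrite /cons_map behead_cons theadE !sum_cons ng.
- move=> x r; case/tupleP: x => x v.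
  rewrite [in LHS]scale_cons /cons_map !behead_cons !theadE.
  by rewrite [in RHS]scale_cons sg.
Qed.

Lemma ball_symmetry_neg_head n : ball_symmetry (@neg_head n).
Proof.
split.
- apply: measurable_cons; last exact: measurable_behead.
  by apply: measurableT_comp => //; exact: measurable_thead.
- move=> A mA /=.
  pose F (x : measurableTypeR R) := volume [set v : n.-tuple R | A [tuple of x :: v]].
  have mF : measurable_fun setT F.
    apply: (measurable_volume (B := [set p : measurableTypeR R * n.-tuple R
                                      | A [tuple of p.1 :: p.2]])).
    rewrite -[X in measurable X]setTI.
    apply: (_ : measurable_fun setT
      (fun p : measurableTypeR R * n.-tuple R => [tuple of p.1 :: p.2])) => //.
    exact: measurable_cons.
  transitivity (\int[@lebesgue_measure R]_x F (- x)%R)%E.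
    apply: eq_integral => x _; congr volume; apply/funext => v /=.
    by rewrite /neg_head behead_cons theadE.
  rewrite -(@ge0_integral_pushforward _ _ _ _ R
    (-%R : measurableTypeR R -> measurableTypeR R) _ lebesgue_measure setT F)//;
    last first.
    by move=> x _; exact: volume_ge0.
  by apply: eq_measure_integral => // B mB _; exact: lebesgue_measureN.
- move=> x; case/tupleP: x => x v.
  by rewrite /neg_head behead_cons theadE !sum_cons sqrrN.
- move=> x r; case/tupleP: x => x v.
  rewrite [in LHS]scale_cons /neg_head !behead_cons !theadE.
  by rewrite [in RHS]scale_cons mulNr.
Qed.

Lemma ball_symmetry_swap_head n : ball_symmetry (@swap_head n).
Proof.
have mtl k : measurable_fun setT (fun x : k.+1.-tuple R => [tuple of behead x]).
  exact: measurable_behead.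
split.
- apply: measurable_cons.
    by apply: (measurableT_comp (@measurable_thead n)); exact: mtl.
  apply: measurable_cons; first exact: measurable_thead.
  by apply: (measurableT_comp (mtl n)); exact: mtl.
- move=> A mA /=.
  pose F (p : measurableTypeR R * measurableTypeR R) :=
    volume [set v : n.-tuple R | A [tuple of p.1 :: p.2 :: v]].
  have mF : measurable_fun setT F.
    apply: (measurable_volume
      (B := [set q : (measurableTypeR R * measurableTypeR R) * n.-tuple R
               | A [tuple of q.1.1 :: q.1.2 :: q.2]])).
    rewrite -[X in measurable X]setTI.
    apply: (_ : measurable_fun setT
      (fun q : (measurableTypeR R * measurableTypeR R) * n.-tuple R =>
         [tuple of q.1.1 :: [tuple of q.1.2 :: q.2]])) => //.
    apply: measurable_cons.
      exact: (measurableT_comp measurable_fst measurable_fst).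
    apply: measurable_cons => //.
    exact: (measurableT_comp measurable_snd measurable_fst).
  have F0 p : (0 <= F p)%E by exact: volume_ge0.
  transitivity (\int[@lebesgue_measure R]_x \int[@lebesgue_measure R]_y F (y, x))%E.
    apply: eq_integral => x _; apply: eq_integral => y _.
    congr volume; apply/funext => v /=; congr A; exact: val_inj.
  transitivity (\int[@lebesgue_measure R]_x \int[@lebesgue_measure R]_y F (x, y))%E.
    exact/esym/(@fubini_tonelli _ _ _ _ R lebesgue_measure lebesgue_measure
    F mF F0).
  by [].
- move=> x; case/tupleP: x => x v; case/tupleP: v => y v.
  by rewrite /swap_head !behead_cons !theadE !sum_cons addrCA.
- move=> x r; case/tupleP: x => x v; case/tupleP: v => y v.
  rewrite [in LHS]scale_cons [in LHS]scale_cons /swap_head.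
  by rewrite !behead_cons !theadE [in RHS]scale_cons [in RHS]scale_cons.
Qed.

(** A coordinate is brought to the front by exchanging the two leading
    coordinates after moving it to the front of the tail. *)
Lemma coordinate_transport n (i j : 'I_n) : exists2 g : n.-tuple R -> n.-tuple R,
  ball_symmetry g & forall x, tnth (g x) i = tnth x j.
Proof.
elim: n i j => [[] //|n IHn] i j.
case: (unliftP ord0 i) => [i'|] -> {i}; case: (unliftP ord0 j) => [j'|] -> {j}.
- have [g sg gE] := IHn i' j'; exists (cons_map g); first exact: ball_symmetry_cons.
  move=> x; case/tupleP: x => x v.
  by rewrite /cons_map behead_cons !tnthS gE.
- case: n IHn i' => [_ []//|n] IHn i'.
  have [g sg gE] := IHn i' ord0; exists (cons_map g \o @swap_head n).
    by apply: ball_symmetry_comp; [exact: ball_symmetry_cons|exact: ball_symmetry_swap_head].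
  move=> x; case/tupleP: x => x v; case/tupleP: v => y v.
  by rewrite /= /cons_map /swap_head !behead_cons !theadE tnthS gE !tnth0.
- case: n IHn j' => [_ []//|n] IHn j'.
  have [g sg gE] := IHn ord0 j'; exists (@swap_head n \o cons_map g).
    by apply: ball_symmetry_comp; [exact: ball_symmetry_swap_head|exact: ball_symmetry_cons].
  move=> x; case/tupleP: x => x v.
  by rewrite /= /cons_map /swap_head !behead_cons tnth0 /thead gE tnthS.
- by exists id => //; exact: ball_symmetry_id.
Qed.

Lemma coordinate_flip n (i : 'I_n) : exists2 g : n.-tuple R -> n.-tuple R,
  ball_symmetry g &
  forall x j, tnth (g x) j = if j == i then - tnth x j else tnth x j.
Proof.
elim: n i => [[] //|n IHn] i.
case: (unliftP ord0 i) => [i'|] ->.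
- have [g sg gE] := IHn i'; exists (cons_map g); first exact: ball_symmetry_cons.
  move=> x j; case/tupleP: x => x v; rewrite /cons_map behead_cons.
  case: (unliftP ord0 j) => [j'|] ->; last by rewrite !tnth0.
  by rewrite !tnthS gE (inj_eq lift_inj).
- exists (@neg_head n); first exact: ball_symmetry_neg_head.
  move=> x j; case/tupleP: x => x v; rewrite /neg_head behead_cons theadE.
  case: (unliftP ord0 j) => [j'|] ->; first by rewrite !tnthS eq_sym (negbTE (neq_lift _ _)).
  by rewrite !tnth0 eqxx.
Qed.

Lemma measurable_enorm n : measurable_fun setT (@enorm R n).
Proof.
have -> : @enorm R n = Num.sqrt \o (fun x => \sum_(i < n) tnth x i ^+ 2) by [].
apply: measurableT_comp.
  by apply: continuous_measurable_fun; exact: sqrt_continuous.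
apply: measurable_sum => i; apply: measurable_funX; exact: measurable_tnth.
Qed.

Lemma measurable_ball_sector n (A : set (n.-tuple R)) : measurable A ->
  measurable (ball_sector A).
Proof.
move=> mA.
pose r (x : n.-tuple R) := [tuple tnth x i * enorm x `^ (-1) | i < n].
have -> : ball_sector A = [set x | 0 < enorm x] `&` ~` [set x | 1 < enorm x] `&` r @^-1` A.
  apply/seteqP; split => x /=.
    move=> [/andP[x0 x1] Ax]; split; first by split => //; apply/negP; rewrite -leNgt.
    rewrite (_ : r x = [tuple tnth x i / enorm x | i < n])//.
    by apply: eq_from_tnth => i; rewrite !tnth_mktuple powR_inv1// ltW.
  move=> [[x0 /negP]]; rewrite -leNgt => x1 Ax; split; first by rewrite x0.
  rewrite (_ : [tuple tnth x i / enorm x | i < n] = r x)//.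
  by apply: eq_from_tnth => i; rewrite !tnth_mktuple powR_inv1// ltW.
apply: measurableI; first apply: measurableI.
- apply: measurable_set_ltr => //; exact: measurable_enorm.
- apply: measurableC; apply: measurable_set_ltr => //; exact: measurable_enorm.
rewrite -[X in measurable X]setTI.
have mr : measurable_fun setT r.
  apply/measurable_fun_tnthP => i.
  rewrite (_ : _ \o _ = fun x => tnth x i * enorm x `^ (-1)); last first.
    by apply/funext => x /=; rewrite tnth_mktuple.
  apply: measurable_funM; first exact: measurable_tnth.
  apply: (measurableT_comp (f := fun y : R => y `^ (-1))); first exact: measurable_powR.
  exact: measurable_enorm.
exact: mr.
Qed.

Lemma sphere_uniform_symmetry n (g : n.-tuple R -> n.-tuple R) A :
  ball_symmetry g -> measurable A ->
  sphere_uniform (g @^-1` A) = sphere_uniform A.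
Proof.
move=> sg mA; rewrite /sphere_uniform; congr (fine _ / _).
rewrite -[RHS](symmetry_volume sg); last exact: measurable_ball_sector.
have nE x : enorm (g x) = enorm x by rewrite /enorm (symmetry_norm sg).
congr volume; apply/funext => x; rewrite /ball_sector /=.
by rewrite nE (symmetry_scale sg).
Qed.

End Volume.

Section SphereMoments.
Context d (T : measurableType d) (R : realType) (P : probability T R).

(** A bounded odd function that agrees with the identity on the coordinates of
    unit vectors: directions have norm one only almost surely, and clipping
    their coordinates gives variables bounded everywhere. *)
Definition clip (x : R) : R := Num.max (- 1) (Num.min 1 x).

Lemma clip_le1 x : `|clip x| <= 1.
Proof.
rewrite ler_norml /clip le_max lexx /= ge_max ge_min lexx /= andbT.
by lra.
Qed.

Lemma clip_id x : `|x| <= 1 -> clip x = x.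
Proof.
by rewrite ler_norml => /andP[x1 x2]; rewrite /clip min_r// max_r.
Qed.

Lemma clipN x : clip (- x) = - clip x.
Proof.
have low y : y <= - 1 -> clip y = - 1.
  by move=> y1; rewrite /clip min_r ?max_l//; lra.
have high y : 1 <= y -> clip y = 1.
  by move=> y1; rewrite /clip min_l ?max_r//; lra.
case: (lerP x (- 1)) => x1; first by rewrite (low x)// high ?opprK//; lra.
case: (lerP 1 x) => x2; first by rewrite (high x)// low//; lra.
by rewrite !clip_id// ler_norml; apply/andP; split; lra.
Qed.

Lemma measurable_clip : measurable_fun setT clip.
Proof.
by apply: measurable_maxr => //; exact: measurable_minr.
Qed.

Context m (U : T -> m.-tuple R).
Hypothesis mU : measurable_fun setT U.
Hypothesis U_law : forall A, measurable A -> P (U @^-1` A) = (sphere_uniform A)%:E.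

(** A uniform direction exists only if the ball has positive finite volume, so
    the proportion of the ball lying over the unit sphere itself is one. *)
Lemma uniform_norm : {ae P, forall w, enorm (U w) = 1}.
Proof.
pose S := [set x : m.-tuple R | enorm x = 1].
have mS : measurable S.
  rewrite -[X in measurable X]setTI.
  exact: (measurable_enorm measurableT (Y := [set 1])).
have US : P (U @^-1` S) = 1%E.
  rewrite U_law// -(probability_setT P) -(preimage_setT U) U_law//.
  congr (fine (volume _) / _)%:E; apply/seteqP; split => x [x01 Sx]; split => //=.
  rewrite /S /= /enorm.
  under eq_bigr do rewrite tnth_mktuple expr_div_n.
  move: x01 => /andP[x0 _].
  rewrite -mulr_suml -[X in X / _]sqr_sqrtr; last by apply: sumr_ge0 => i _; exact: sqr_ge0.
  by rewrite divff ?sqrtr1// expf_neq0// gt_eqF.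
have mUS : measurable (U @^-1` S).
  by rewrite -[X in measurable X]setTI; exact: mU.
exists (~` (U @^-1` S)); split.
- exact: measurableC.
- by rewrite probability_setC// US subee.
- by move=> w.
Qed.

Lemma uniform_coordinate_le1 : {ae P, forall w i, `|tnth (U w) i| <= 1}.
Proof.
apply: filterS uniform_norm => w /= nw i.
rewrite -(@expr_le1 _ 2)// -normrX ger0_norm ?sqr_ge0//.
have -> : 1 = enorm (U w) ^+ 2 by rewrite nw expr1n.
rewrite sqr_sqrtr; last by apply: sumr_ge0 => k _; exact: sqr_ge0.
by rewrite (bigD1 i)//= lerDl; apply: sumr_ge0 => k _; exact: sqr_ge0.
Qed.

Lemma expect_symmetry (g : m.-tuple R -> m.-tuple R) (h : m.-tuple R -> R) :
  ball_symmetry g -> measurable_fun setT h -> (exists M, forall y, `|h y| <= M) ->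
  \int[P]_w h (g (U w)) = \int[P]_w h (U w).
Proof.
move=> sg mh bh; have mg := symmetry_measurable sg.
apply: (@expect_same_law _ T R P _ _ (g \o U) U h) => //; first exact: measurableT_comp.
move=> A mA; rewrite comp_preimage !U_law ?sphere_uniform_symmetry//.
by rewrite -[X in measurable X]setTI; exact: mg.
Qed.

Lemma measurable_clip_tnth i : measurable_fun setT (fun y : m.-tuple R => clip (tnth y i)).
Proof.
by apply: measurableT_comp; [exact: measurable_clip|exact: measurable_tnth].
Qed.

Lemma bounded_clip_tnth i : bounded_measurable (fun y : m.-tuple R => clip (tnth y i)).
Proof.
by split; [exact: measurable_clip_tnth|exists 1 => y; exact: clip_le1].
Qed.

Lemma bounded_clip_coordinate i : bounded_measurable (fun w => clip (tnth (U w) i)).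
Proof.
by have [mh bh] := bounded_clip_tnth i; exact: (bounded_measurable_comp mh bh mU).
Qed.

Lemma uniform_mean i : \int[P]_w clip (tnth (U w) i) = 0.
Proof.
have [g sg gE] := coordinate_flip R i; have [mh bh] := bounded_clip_tnth i.
have := expect_symmetry sg mh bh.
under eq_Rintegral do rewrite gE eqxx clipN -mulN1r.
rewrite expectZ; last exact: bounded_clip_coordinate.
by move=> ?; lra.
Qed.

Lemma uniform_covariance i j : i != j ->
  \int[P]_w (clip (tnth (U w) i) * clip (tnth (U w) j)) = 0.
Proof.
move=> ij; have [g sg gE] := coordinate_flip R i.
have [mh bh] := bounded_measurableM (bounded_clip_tnth i) (bounded_clip_tnth j).
have := expect_symmetry sg mh bh.
under eq_Rintegral do rewrite !gE eqxx eq_sym (negbTE ij) clipN mulNr -mulN1r.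
rewrite expectZ; last by apply: bounded_measurableM; exact: bounded_clip_coordinate.
by move=> ?; lra.
Qed.

(** The squared coordinates have equal means and add up to 1. *)
Lemma uniform_second_moment i : (0 < m)%N ->
  \int[P]_w (clip (tnth (U w) i) * clip (tnth (U w) i)) = m%:R^-1.
Proof.
move=> m0.
have e j : \int[P]_w (clip (tnth (U w) j) * clip (tnth (U w) j))
         = \int[P]_w (clip (tnth (U w) i) * clip (tnth (U w) i)).
  have [g sg gE] := coordinate_transport R i j.
  have [mh bh] := bounded_measurableM (bounded_clip_tnth i) (bounded_clip_tnth i).
  rewrite -(expect_symmetry sg mh bh).
  by apply: eq_Rintegral => w _; rewrite gE.
have bc j : bounded_measurable (fun w => clip (tnth (U w) j) * clip (tnth (U w) j)).
  by apply: bounded_measurableM; exact: bounded_clip_coordinate.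
have : \int[P]_w (\sum_(j < m) clip (tnth (U w) j) * clip (tnth (U w) j)) = 1.
  rewrite -[RHS](expect_cst P); apply: expect_ae_eq.
  - by have [] := bounded_measurable_sum (index_enum 'I_m) bc.
  - exact: measurable_cst.
  apply: filterS2 uniform_norm uniform_coordinate_le1 => w nw Uw.
  under eq_bigr do rewrite clip_id// -expr2.
  have : enorm (U w) ^+ 2 = 1 by rewrite nw expr1n.
  by rewrite sqr_sqrtr//; apply: sumr_ge0 => k _; exact: sqr_ge0.
rewrite expect_sum// (eq_bigr _ (fun j _ => e j)) sumr_const card_ord => h.
have m0' : m%:R != 0 :> R by rewrite pnatr_eq0 -lt0n.
by apply: (mulIf m0'); rewrite mulVf// mulr_natr.
Qed.

End SphereMoments.

(** * Products of independent directions *)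

Section Driver.
Context d (T : measurableType d) (R : realType) (P : probability T R).
Context m (lambda : R) (N : R -> T -> nat) (U : nat -> T -> m.-tuple R).
Hypothesis driver : flight_driver P lambda N U.

Let poisson := flight_switching driver.
Let mU := flight_direction_measurable driver.
Let mN := poisson_measurable poisson.

Lemma measurable_direction v (A : set (m.-tuple R)) : measurable A ->
  measurable (U v @^-1` A).
Proof. by move=> mA; rewrite -[X in measurable X]setTI; exact: mU. Qed.

Lemma measurable_switching s (A : set nat) : 0 <= s -> measurable (N s @^-1` A).
Proof. by move=> s0; rewrite -[X in measurable X]setTI; exact: mN. Qed.

Lemma direction_process_bigcap (r : seq nat) (A : nat -> set (m.-tuple R)) :
  (forall v, measurable (A v)) ->
  sigma_process [set: nat] U (\big[setI/setT]_(v <- r) (U v @^-1` A v)).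
Proof.
move=> mA; rewrite /sigma_process.
set G := \bigcup_(i in _) _.
apply: (@bigsetI_measurable _ (g_sigma_algebraType G)) => v _.
apply: sub_sigma_algebra; exists v => //.
by exists (A v) => //; rewrite setTI.
Qed.

Lemma directions_bigcap (r : seq nat) (A : nat -> set (m.-tuple R)) : uniq r ->
  (forall v, measurable (A v)) ->
  P (\big[setI/setT]_(v <- r) (U v @^-1` A v)) = (\prod_(v <- r) P (U v @^-1` A v))%E.
Proof.
move=> ur mA.
have := flight_directions_independent driver (J := [fset v in r]%fset)
  (E := fun v => U v @^-1` A v).
rewrite (_ : [set` [fset v in r]%fset] = [set` r]); last first.
  by apply/seteqP; split => v /=; rewrite inE.
rewrite bigcap_seq => ->; last first.
  by move=> v _; exists (A v) => //; rewrite setTI.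
apply: perm_big; apply: uniq_perm => //.
by move=> v; rewrite inE.
Qed.

(** The factors h v (U v) are pulled out of the integral one at a time: by
    induction the remaining ones, together with any events on other directions,
    rescale the law of U v by a constant. *)
Lemma directions_factor (B : set T) (s r : seq nat) (h : nat -> m.-tuple R -> R)
    (A : nat -> set (m.-tuple R)) :
  sigma_process [set u : R | 0 <= u] N B -> measurable B ->
  uniq (s ++ r) -> (forall v, bounded_measurable (h v)) ->
  (forall v, measurable (A v)) ->
  \int[P]_w (\1_B w * (\prod_(v <- s) h v (U v w)) *
             \prod_(v <- r) \1_(U v @^-1` A v) w)
  = fine (P B) * (\prod_(v <- s) \int[P]_w h v (U v w)) *
    \prod_(v <- r) fine (P (U v @^-1` A v)).
Proof.
move=> NB mB + bh; have bB := @bounded_measurable_indic _ T R B mB.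
have bhU v : bounded_measurable (fun w => h v (U v w)).
  by have [mh hM] := bh v; exact: (bounded_measurable_comp mh hM (mU v)).
elim: s r A => [|v s IHs] r A /= + mA.
  move=> ur; under eq_Rintegral do rewrite big_nil mulr1.
  rewrite big_nil mulr1.
  set G := \big[setI/setT]_(v <- r) (U v @^-1` A v).
  have mG : measurable G.
    by apply: bigsetI_measurable => v _; exact: measurable_direction.
  transitivity (\int[P]_w \1_(G `&` B) w).
    apply: eq_Rintegral => w _; rewrite /G setIC.
    elim: r {ur G mG} => [|v r IHr]; first by rewrite !big_nil setIT mulr1.
    by rewrite !big_cons setICA indicI /= -IHr; ring.
  rewrite expect_indic; last exact: measurableI.
  rewrite (flight_independent driver (direction_process_bigcap r mA) NB).
  rewrite fineM ?fin_num_measure// mulrC; congr (_ * _).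
  rewrite directions_bigcap//.
  elim: r {ur G mG} => [|v r IHr]; first by rewrite !big_nil.
  rewrite !big_cons fineM ?IHr ?fin_num_measure//; first exact: measurable_direction.
  rewrite prode_fin_num// => i _ ; rewrite fin_num_measure//.
  exact: measurable_direction.
move=> /andP[vsr usr]; rewrite big_cons.
move: (vsr); rewrite mem_cat negb_or => /andP[vs vr].
pose W w := \1_B w * (\prod_(v <- s) h v (U v w)) *
            \prod_(v <- r) \1_(U v @^-1` A v) w.
have bW : bounded_measurable W.
  apply: bounded_measurableM; first apply: bounded_measurableM => //.
    exact: bounded_measurable_prod.
  apply: bounded_measurable_prod => k; apply: bounded_measurable_indic.
  exact: measurable_direction.
transitivity (\int[P]_w (W w * h v (U v w))).
  by apply: eq_Rintegral => w _; rewrite /W big_cons; ring.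
have [mh hM] := bh v.
rewrite (@factorization _ T R P _ _ W (U v)
  (fine (P B) * (\prod_(v <- s) \int[P]_w h v (U v w)) *
    \prod_(v <- r) fine (P (U v @^-1` A v)))) //; first by ring.
move=> A0 mA0.
pose A' k := if k == v then A0 else A k.
have mA' k : measurable (A' k) by rewrite /A'; case: ifP.
have A'r k : k \in r -> A' k = A k.
  by rewrite /A'; case: eqP => // -> vr'; rewrite vr' in vr.
(* The event U v \in A0 joins the events on the directions of r. *)
transitivity (\int[P]_w (\1_B w * (\prod_(v <- s) h v (U v w)) *
             \prod_(v <- v :: r) \1_(U v @^-1` A' v) w)).
  apply: eq_Rintegral => w _; rewrite big_cons.
  have -> : \prod_(k <- r) \1_(U k @^-1` A' k) w
          = \prod_(k <- r) \1_(U k @^-1` A k) w :> R.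
    by apply: eq_big_seq => k kr; rewrite A'r.
  by rewrite /A' eqxx /W; ring.
rewrite IHs//; last first.
  by rewrite uniq_catC /= mem_cat orbC -mem_cat vsr uniq_catC usr.
rewrite big_cons.
have -> : \prod_(k <- r) fine (P (U k @^-1` A' k))
        = \prod_(k <- r) fine (P (U k @^-1` A k)).
  by apply: eq_big_seq => k kr; rewrite A'r.
by rewrite /A' eqxx; ring.
Qed.

Lemma direction_same_law v (h : m.-tuple R -> R) : bounded_measurable h ->
  \int[P]_w h (U v w) = \int[P]_w h (U 0 w).
Proof.
move=> [mh bh]; apply: expect_same_law => // A mA.
by rewrite !(flight_direction_uniform driver).
Qed.

Context (i j : 'I_m).
Hypothesis ij : i != j.

Let ci (y : m.-tuple R) := clip (tnth y i).
Let cj (y : m.-tuple R) := clip (tnth y j).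

Definition mixed_moment : R :=
  \int[P]_w (ci (U 0 w) * ci (U 0 w) * (cj (U 0 w) * cj (U 0 w))).

Lemma bounded_mixed : bounded_measurable
  (fun y : m.-tuple R => ci y * ci y * (cj y * cj y)).
Proof.
by apply: bounded_measurableM; apply: bounded_measurableM; exact: bounded_clip_tnth.
Qed.

Lemma mixed_moment_itv : 0 <= mixed_moment <= 1.
Proof.
have [mh bh] := bounded_mixed.
have bU := bounded_measurable_comp mh bh (mU 0).
apply/andP; split.
  by apply: Rintegral_ge0 => w _; rewrite -!expr2 mulr_ge0 ?sqr_ge0.
apply: (le_trans (ler_norm _)); apply: norm_expect_le => // w.
by rewrite !normrM !mulr_ile1 ?mulr_ge0 ?clip_le1.
Qed.

(** The expectation of the product of the first coordinate of directions n1, n2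
    and the second coordinate of directions n3, n4. *)
Definition pairing_moment (n1 n2 n3 n4 : nat) : R :=
  if (n1 == n2) && (n3 == n4) then
    if n1 == n3 then mixed_moment else m%:R^-1 ^+ 2
  else 0.

(** The four factors are grouped by direction. A direction that carries an odd
    number of factors of one coordinate contributes the factor 0. *)
Lemma four_directions (B : set T) (n1 n2 n3 n4 : nat) :
  sigma_process [set u : R | 0 <= u] N B -> measurable B ->
  \int[P]_w (\1_B w * (ci (U n1 w) * ci (U n2 w) * (cj (U n3 w) * cj (U n4 w))))
  = fine (P B) * pairing_moment n1 n2 n3 n4.
Proof.
move=> NB mB.
have m0 : (0 < m)%N by apply: leq_ltn_trans (ltn_ord i).
pose pick (n v : nat) (f : m.-tuple R -> R) y : R := if n == v then f y else 1.
have bpick n v f : bounded_measurable f -> bounded_measurable (pick n v f).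
  move=> bf; rewrite /pick; case: (n == v) => //.
  exact: bounded_measurable_cst.
pose h v y := pick n1 v ci y * pick n2 v ci y * (pick n3 v cj y * pick n4 v cj y).
have bi : bounded_measurable ci by exact: bounded_clip_tnth.
have bj : bounded_measurable cj by exact: bounded_clip_tnth.
have bh v : bounded_measurable (h v).
  by apply: bounded_measurableM; apply: bounded_measurableM; exact: bpick.
pose s := undup [:: n1; n2; n3; n4].
have us : uniq s by exact: undup_uniq.
have := @directions_factor B s [::] h (fun=> setT) NB mB.
rewrite cats0 big_nil mulr1 => /(_ us bh (fun=> measurableT)).
have pickE n f w : n \in s -> \prod_(v <- s) pick n v f (U v w) = f (U n w).
  move=> ns; rewrite (bigD1_seq n)//= /pick eqxx big1 ?mulr1// => v.
  by rewrite eq_sym => /negbTE ->.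
have hE w : \prod_(v <- s) h v (U v w)
    = ci (U n1 w) * ci (U n2 w) * (cj (U n3 w) * cj (U n4 w)).
  by rewrite /h !big_split /= !pickE// mem_undup !inE eqxx ?orbT.
under eq_Rintegral do rewrite big_nil mulr1 hE.
move=> ->; congr (_ * _).
under eq_bigr do rewrite direction_same_law//.
have U0_law := flight_direction_uniform driver 0.
have Eci : \int[P]_w ci (U 0 w) = 0.
  by apply: (uniform_mean (U := U 0)) => //; exact: U0_law.
have Ecj : \int[P]_w cj (U 0 w) = 0.
  by apply: (uniform_mean (U := U 0)) => //; exact: U0_law.
have Ecij : \int[P]_w (ci (U 0 w) * cj (U 0 w)) = 0.
  by apply: (uniform_covariance (U := U 0)) => //; exact: U0_law.
have Ecii : \int[P]_w (ci (U 0 w) * ci (U 0 w)) = m%:R^-1.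
  by apply: (uniform_second_moment (U := U 0)) => //; exact: U0_law.
have Ecjj : \int[P]_w (cj (U 0 w) * cj (U 0 w)) = m%:R^-1.
  by apply: (uniform_second_moment (U := U 0)) => //; exact: U0_law.
have kill v : v \in s -> \int[P]_w h v (U 0 w) = 0 ->
    \prod_(u <- s) \int[P]_w h u (U 0 w) = 0.
  by move=> vs hv; rewrite (bigD1_seq v)//= hv mul0r.
have ns : [/\ n1 \in s, n2 \in s, n3 \in s & n4 \in s].
  by split; rewrite mem_undup !inE eqxx ?orbT.
case: ns => ns1 ns2 ns3 ns4.
rewrite /pairing_moment; case: (eqVneq n1 n2) => [e12|n12] /=.
  case: (eqVneq n3 n4) => [e34|n34] /=.
    rewrite /s /h -e12 -e34.
    case: (eqVneq n1 n3) => [<-|n13] /=.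
      rewrite !inE !eqxx /= big_seq1 /mixed_moment.
      by apply: eq_Rintegral => w _; rewrite /pick eqxx.
    rewrite !inE !eqxx (negbTE n13) /= !big_cons big_nil mulr1 expr2.
    congr (_ * _).
      rewrite -Ecii; apply: eq_Rintegral => w _.
      by rewrite /pick eqxx eq_sym (negbTE n13) !mulr1.
    rewrite -Ecjj; apply: eq_Rintegral => w _.
    by rewrite /pick eqxx (negbTE n13) !mul1r.
  case: (eqVneq n1 n3) => [e13|n13].
    apply: (kill n4) => //; rewrite -Ecj; apply: eq_Rintegral => w _.
    by rewrite /h /pick -e12 e13 (negbTE n34) eqxx !mul1r.
  apply: (kill n3) => //; rewrite -Ecj; apply: eq_Rintegral => w _.
  by rewrite /h /pick -e12 (negbTE n13) eqxx eq_sym (negbTE n34) !mul1r mulr1.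
case: (eqVneq n1 n3) => [e13|n13].
  case: (eqVneq n1 n4) => [e14|n14].
    apply: (kill n2) => //; rewrite -Eci; apply: eq_Rintegral => w _.
    by rewrite /h /pick -e13 -e14 (negbTE n12) eqxx mul1r !mulr1.
  apply: (kill n1) => //; rewrite -Ecij; apply: eq_Rintegral => w _.
  by rewrite /h /pick -e13 eqxx !(eq_sym _ n1) (negbTE n12) (negbTE n14) !mulr1.
case: (eqVneq n1 n4) => [e14|n14].
  apply: (kill n1) => //; rewrite -Ecij; apply: eq_Rintegral => w _.
  by rewrite /h /pick -e14 eqxx !(eq_sym _ n1) (negbTE n12) (negbTE n13) mulr1 mul1r.
apply: (kill n1) => //; rewrite -Eci; apply: eq_Rintegral => w _.
by rewrite /h /pick eqxx !(eq_sym _ n1) (negbTE n12) (negbTE n13) (negbTE n14) !mulr1.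
Qed.

End Driver.

(** * Velocities at four times *)

Section Switching.
Context d (T : measurableType d) (R : realType) (P : probability T R).
Context (lambda : R) (N : R -> T -> nat).
Hypothesis poisson : poisson_process P lambda N.
Hypothesis lambda_gt0 : 0 < lambda.

Definition no_switch (a b : R) : set T := [set w | N a w = N b w].

Lemma no_switchC a b : no_switch a b = no_switch b a.
Proof. by apply/seteqP; split => w. Qed.

Lemma measurable_no_switch a b : 0 <= a -> 0 <= b -> measurable (no_switch a b).
Proof.
move=> a0 b0; rewrite (_ : no_switch a b = [set w | N a w == N b w]); last first.
  by apply/seteqP; split => w /= /eqP.
rewrite -[X in measurable X]setTI.
exact: (measurable_fun_eqn (poisson_measurable poisson a0)
  (poisson_measurable poisson b0) measurableT (Y := [set true])).
Qed.

Lemma no_switchE a b w : 0 <= a <= b ->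
  no_switch a b w <-> (N b w - N a w)%N = 0%N.
Proof.
move=> ab; have le := poisson_nondecreasing poisson w ab.
rewrite /no_switch /=; split => [->|/eqP]; first exact: subnn.
by rewrite subn_eq0 => ba; apply/eqP; rewrite eqn_leq le.
Qed.

Lemma no_switch_prob_le a b : 0 <= a <= b ->
  fine (P (no_switch a b)) = expR (- (lambda * (b - a))).
Proof.
move=> /andP[a0]; rewrite le_eqVlt => /predU1P[<-|ab].
  rewrite (_ : no_switch a a = setT); last by apply/seteqP; split.
  by rewrite probability_setT subrr mulr0 oppr0 expR0.
have -> : no_switch a b = [set w | (N b w - N a w)%N = 0%N].
  by apply/seteqP; split => w; apply no_switchE; rewrite a0 ltW.
rewrite (poisson_increments poisson); last by rewrite a0.
rewrite /= /poisson_pmf mulr_gt0 ?subr_gt0//.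
by rewrite expr0 fact0 invr1 !mul1r.
Qed.

Lemma no_switch_prob a b : 0 <= a -> 0 <= b ->
  fine (P (no_switch a b)) = expR (- (lambda * `|a - b|)).
Proof.
move=> a0 b0; case: (lerP a b) => ab; last first.
  by rewrite no_switchC no_switch_prob_le// b0 ltW.
by rewrite no_switch_prob_le ?a0// opprB.
Qed.

Lemma no_switch_independent a b c e : 0 <= a <= b -> b <= c <= e ->
  fine (P (no_switch a b `&` no_switch c e))
  = expR (- (lambda * (b - a))) * expR (- (lambda * (e - c))).
Proof.
move=> /andP[a0 ab] /andP[bc ce].
have c0 : 0 <= c by rewrite (le_trans a0)// (le_trans ab).
(* The two intervals are the first and the third step of this sequence. *)
pose s (k : nat) := if k is 0 then a else if k is 1 then b else if k is 2 then c else e.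
have s_nd : nondecreasing_seq s.
  apply/nondecreasing_seqP => k; case: k => [|[|[|k]]] //=.
have := poisson_independent_increments poisson (s := s) a0 s_nd
  (J := [fset 0%N; 2%N]%fset)
  (E := fun k => [set w | (N (s k.+1) w - N (s k) w)%N = 0%N]).
rewrite (_ : \bigcap_(k in _) _ = no_switch a b `&` no_switch c e); last first.
  apply/seteqP; split => w /=.
    move=> h; split; apply no_switchE.
    - by rewrite a0.
    - by apply: (h 0%N); rewrite /= !inE.
    - by rewrite c0.
    - by apply: (h 2%N); rewrite /= !inE.
  move=> [h1 h2] k /=; rewrite !inE => /orP[] /eqP -> /=; apply/no_switchE => //.
    by rewrite a0.
  by rewrite c0.
rewrite big_fsetU1 ?inE//= big_seq_fset1 /= => ->; last first.
  by move=> k _; exists [set 0%N] => //; rewrite setTI.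
have E x y : 0 <= x <= y -> [set w | (N y w - N x w)%N = 0%N] = no_switch x y.
  by move=> xy; apply/seteqP; split => w /=; apply no_switchE.
have b0 : 0 <= b := le_trans a0 ab.
rewrite !E ?a0 ?c0// fineM ?fin_num_measure//; last 2 first.
- exact: measurable_no_switch.
- by apply: measurable_no_switch => //; rewrite (le_trans c0).
by rewrite !no_switch_prob_le ?a0 ?c0.
Qed.

(** Two constancy intervals that are apart are independent; two that meet force
    constancy on the whole span, so both the joint probability and the product
    are at most the probability of no switch on the span. *)
Lemma no_switch_decorrelation (a b c e D : R) : 0 <= a <= b -> 0 <= c <= e ->
  D <= Num.max b e - Num.min a c ->
  `|fine (P (no_switch a b `&` no_switch c e))
    - expR (- (lambda * (b - a))) * expR (- (lambda * (e - c)))|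
  <= expR (- (lambda * D)).
Proof.
move=> /andP[a0 ab] /andP[c0 ce] Dle.
have b0 : 0 <= b := le_trans a0 ab.
have e0 : 0 <= e := le_trans c0 ce.
case: (lerP b c) => bc.
  by rewrite no_switch_independent ?a0 ?bc// subrr normr0 expR_ge0.
case: (lerP e a) => ea.
  rewrite setIC no_switch_independent ?c0 ?ea// [X in X - _]mulrC.
  by rewrite subrr normr0 expR_ge0.
have mn0 : 0 <= Num.min a c by rewrite le_min a0.
have mx0 : 0 <= Num.max b e by rewrite le_max b0.
have le_mnmx : Num.min a c <= Num.max b e.
  by rewrite ge_min le_max ab.
have sub : no_switch a b `&` no_switch c e `<=` no_switch (Num.min a c) (Num.max b e).
  move=> w [] /= h1 h2.
  have h3 : N a w = N c w.
    apply/eqP; rewrite eqn_leq; apply/andP; split.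
      by rewrite h2; apply: (poisson_nondecreasing poisson); rewrite a0 ltW.
    by rewrite h1; apply: (poisson_nondecreasing poisson); rewrite c0 ltW.
  rewrite /no_switch /= /Num.min /Num.max.
  by case: ifP; case: ifP => _ _; congruence.
have pab : fine (P (no_switch a b `&` no_switch c e)) <= expR (- (lambda * D)).
  apply: (@le_trans _ _ (fine (P (no_switch (Num.min a c) (Num.max b e))))).
    apply: fine_le; rewrite ?fin_num_measure//.
    - by apply: measurableI; exact: measurable_no_switch.
    - exact: measurable_no_switch.
    - apply: le_measure => //; rewrite inE; last exact: measurable_no_switch.
      by apply: measurableI; exact: measurable_no_switch.
  rewrite no_switch_prob_le ?mn0// ler_expR lerN2.
  by rewrite ler_wpM2l// ltW.
have pp : expR (- (lambda * (b - a))) * expR (- (lambda * (e - c))) <= expR (- (lambda * D)).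
  rewrite -expRD ler_expR -opprD -mulrDr lerN2 ler_wpM2l ?(ltW lambda_gt0)//.
  apply: (le_trans Dle).
  by rewrite /Num.max /Num.min; case: ifP => ?; case: ifP => ?; lra.
have p0 : 0 <= fine (P (no_switch a b `&` no_switch c e)) by rewrite fine_ge0.
have q0 : 0 <= expR (- (lambda * (b - a))) * expR (- (lambda * (e - c))).
  by rewrite mulr_ge0 ?expR_ge0.
by rewrite ler_norml; apply/andP; split; lra.
Qed.

End Switching.

Section FourTimes.
Context d (T : measurableType d) (R : realType) (P : probability T R).
Context m (lambda : R) (N : R -> T -> nat) (U : nat -> T -> m.-tuple R).
Hypothesis driver : flight_driver P lambda N U.
Hypothesis lambda_gt0 : 0 < lambda.
Context (i j : 'I_m).
Hypothesis ij : i != j.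

Let poisson := flight_switching driver.

Definition clipped_velocity (k : 'I_m) (s : R) (w : T) : R :=
  clip (tnth (U (N s w) w) k).

Lemma measurable_sampled (V : nat -> T -> R) (s : R) : 0 <= s ->
  (forall n, measurable_fun setT (V n)) ->
  measurable_fun setT (fun w => V (N s w) w).
Proof.
move=> s0 mV _ A mA; rewrite setTI.
have -> : (fun w => V (N s w) w) @^-1` A
    = \bigcup_n ((N s @^-1` [set n]) `&` V n @^-1` A).
  apply/seteqP; split => [w Aw|w [n _ [/= <-]]//].
  by exists (N s w).
apply: bigcup_measurable => n _; apply: measurableI.
  exact: (measurable_switching driver).
by rewrite -[X in measurable X]setTI; exact: mV.
Qed.

Lemma bounded_clipped_velocity k s : 0 <= s ->
  bounded_measurable (clipped_velocity k s).
Proof.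
move=> s0; split; last by exists 1 => w; exact: clip_le1.
apply: (measurable_sampled (V := fun n w => clip (tnth (U n w) k)) s0) => n.
by have [] := bounded_clip_coordinate (flight_direction_measurable driver n) k.
Qed.

Lemma switching_cell (s1 s2 s3 s4 : R) (n1 n2 n3 n4 : nat) :
  0 <= s1 -> 0 <= s2 -> 0 <= s3 -> 0 <= s4 ->
  let B := (N s1 @^-1` [set n1] `&` N s2 @^-1` [set n2])
           `&` (N s3 @^-1` [set n3] `&` N s4 @^-1` [set n4]) in
  sigma_process [set u : R | 0 <= u] N B /\ measurable B.
Proof.
move=> s10 s20 s30 s40 /=; split; last first.
  by do 2! apply: measurableI; exact: (measurable_switching driver).
rewrite /sigma_process; set G := \bigcup_(k in _) _.
have GN s n : 0 <= s -> measurable (N s @^-1` [set n] : set (g_sigma_algebraType G)).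
  move=> s0; apply: sub_sigma_algebra; exists s => //.
  by exists [set n] => //; rewrite setTI.
have := measurableI _ _ (measurableI _ _ (GN _ n1 s10) (GN _ n2 s20))
  (measurableI _ _ (GN _ n3 s30) (GN _ n4 s40)).
exact.
Qed.

(** Conditionally on the switching process, two pairs of equal velocities
    contribute the squared second moment of a coordinate, and four equal ones
    the mixed moment. *)
Lemma four_times (s1 s2 s3 s4 : R) : 0 <= s1 -> 0 <= s2 -> 0 <= s3 -> 0 <= s4 ->
  \int[P]_w (clipped_velocity i s1 w * clipped_velocity i s2 w *
             (clipped_velocity j s3 w * clipped_velocity j s4 w))
  = m%:R^-1 ^+ 2 * fine (P (no_switch N s1 s2 `&` no_switch N s3 s4))
  + (mixed_moment P U i j - m%:R^-1 ^+ 2) *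
    fine (P (no_switch N s1 s2 `&` no_switch N s3 s4 `&` no_switch N s1 s3)).
Proof.
move=> s10 s20 s30 s40.
have mA : measurable (no_switch N s1 s2 `&` no_switch N s3 s4).
  by apply: measurableI; exact: (measurable_no_switch poisson).
have mB : measurable (no_switch N s1 s2 `&` no_switch N s3 s4 `&` no_switch N s1 s3).
  by apply: measurableI => //; exact: (measurable_no_switch poisson).
have b1 := @bounded_measurable_indic _ T R _ mA.
have b2 := @bounded_measurable_indic _ T R _ mB.
rewrite -!expect_indic// -!expectZ// -expectD;
  [|exact: bounded_measurableZ|exact: bounded_measurableZ].
(* The values of N at the four times partition the space into countably many
   cells, on each of which the four directions are fixed. *)
pose Y w := choice.pickle (N s1 w, N s2 w, N s3 w, N s4 w).
have YE w0 : Y @^-1` [set Y w0] =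
    (N s1 @^-1` [set N s1 w0] `&` N s2 @^-1` [set N s2 w0])
    `&` (N s3 @^-1` [set N s3 w0] `&` N s4 @^-1` [set N s4 w0]).
  apply/seteqP; split => w; last first.
    by move=> [[/= e1 e2] [/= e3 e4]]; rewrite /= /Y e1 e2 e3 e4.
  by move=> /(pcan_inj choice.pickleK) [e1 e2 e3 e4]; split; split.
have Y0 n : (forall w, Y w <> n) -> Y @^-1` [set n] = set0.
  by move=> h; apply/seteqP; split => // w; exact: h.
have cell w0 := switching_cell (N s1 w0) (N s2 w0) (N s3 w0) (N s4 w0) s10 s20 s30 s40.
have bv k s := @bounded_clipped_velocity k s.
apply: (@expect_partition _ T R P Y).
- move=> n; have [[w0 <-]|h] := pselect (exists w, Y w = n).
    by rewrite YE; have [] := cell w0.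
  by rewrite Y0// => w Yw; apply: h; exists w.
- by apply: bounded_measurableM; apply: bounded_measurableM; exact: bv.
- by apply: bounded_measurableD; exact: bounded_measurableZ.
move=> n; have [[w0 <-]|h] := pselect (exists w, Y w = n); last first.
  rewrite Y0; last by move=> w Yw; apply: h; exists w.
  by apply: eq_Rintegral => w _; rewrite indic0 !mulr0.
rewrite YE; set B := _ `&` _ `&` (_ `&` _).
have [NB mBB] := cell w0.
transitivity (\int[P]_w (\1_B w * (clip (tnth (U (N s1 w0) w) i) * clip (tnth (U (N s2 w0) w) i)
   * (clip (tnth (U (N s3 w0) w) j) * clip (tnth (U (N s4 w0) w) j))))).
  apply: eq_Rintegral => w _; rewrite mulrC [\1_B w]indicE.
  case: (boolP (w \in B)) => [|_]; last by rewrite !mul0r.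
  by rewrite inE => -[[/= e1 e2] [/= e3 e4]]; rewrite /clipped_velocity e1 e2 e3 e4.
rewrite (four_directions driver ij)//.
transitivity (\int[P]_w (pairing_moment P U i j (N s1 w0) (N s2 w0) (N s3 w0) (N s4 w0) * \1_B w)).
  by rewrite expectZ ?expect_indic// 1?mulrC//; exact: bounded_measurable_indic.
apply: eq_Rintegral => w _; rewrite [\1_B w]indicE.
case: (boolP (w \in B)) => [|_]; last by rewrite !mulr0.
rewrite inE => -[[/= e1 e2] [/= e3 e4]]; rewrite !mulr1 /pairing_moment -e1 -e2 -e3 -e4.
have nsE a b : \1_(no_switch N a b) w = (N a w == N b w)%:R :> R.
  by rewrite indicE; congr (_%:R); congr nat_of_bool; apply/idP/eqP; rewrite inE.
rewrite !indicI /= !nsE.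
case: (N s1 w == N s2 w); case: (N s3 w == N s4 w); case: (N s1 w == N s3 w) => /=; ring.
Qed.

(** Decoupling the two coincidences and dropping the event that all four times
    lie between the same two switches each cost at most the probability of no
    switch over the distance D. *)
Lemma four_times_decay (s1 s2 s3 s4 D : R) : 0 <= s1 -> 0 <= s2 -> 0 <= s3 -> 0 <= s4 ->
  D <= Num.max `|s1 - s2| (Num.max `|s1 - s3| `|s1 - s4|) ->
  `|\int[P]_w (clipped_velocity i s1 w * clipped_velocity i s2 w *
             (clipped_velocity j s3 w * clipped_velocity j s4 w))
    - m%:R^-1 ^+ 2 * (expR (- (lambda * `|s1 - s2|)) * expR (- (lambda * `|s3 - s4|)))|
  <= 2 * expR (- (lambda * D)).
Proof.
move=> s10 s20 s30 s40 DM.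
have m0 : (0 < m)%N by apply: leq_ltn_trans (ltn_ord i).
set e := expR (- (lambda * D)).
have mns a b : 0 <= a -> 0 <= b -> measurable (no_switch N a b).
  by move=> a0 b0; exact: (measurable_no_switch poisson).
have sq0 : 0 <= m%:R^-1 ^+ 2 :> R by rewrite sqr_ge0.
have sq1 : m%:R^-1 ^+ 2 <= 1 :> R by rewrite expr_le1// invf_le1 ?ltr0n// ler1n.
rewrite four_times//.
set A := no_switch N s1 s2 `&` _; set B := A `&` _.
have PA : `|fine (P A) - expR (- (lambda * `|s1 - s2|)) * expR (- (lambda * `|s3 - s4|))| <= e.
  have -> : A = no_switch N (Num.min s1 s2) (Num.max s1 s2) `&`
                no_switch N (Num.min s3 s4) (Num.max s3 s4).
    rewrite /A /Num.min /Num.max; congr (_ `&` _); case: ifP => _ //; exact: no_switchC.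
  have absE (x y : R) : `|x - y| = Num.max x y - Num.min x y.
    rewrite /Num.max /Num.min; case: ifP => [xy|/negbT].
      by rewrite ler0_norm ?opprB// subr_le0 ltW.
    by rewrite -leNgt => yx; rewrite ger0_norm// subr_ge0.
  rewrite (absE s1) (absE s3); apply: (no_switch_decorrelation poisson lambda_gt0).
  - by rewrite le_min s10 s20 ge_min le_max lexx.
  - by rewrite le_min s30 s40 ge_min le_max lexx.
  - apply: (le_trans DM); set MX := Num.max (Num.max _ _) _; set MN := Num.min _ _.
    have between x : x \in [:: s1; s2; s3; s4] -> MN <= x <= MX.
      by rewrite !inE => /or4P[] /eqP ->; rewrite !ge_min !le_max lexx ?orbT.
    have /andP[? ?] : MN <= s1 <= MX by apply: between; rewrite !inE eqxx.
    have dist x : x \in [:: s1; s2; s3; s4] -> `|s1 - x| <= MX - MN.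
      by move=> /between /andP[? ?]; rewrite ler_norml; apply/andP; split; lra.
    by rewrite !ge_max !dist// !inE eqxx ?orbT.
have PB : 0 <= fine (P B) <= e.
  rewrite fine_ge0//=.
  have sub (x y : R) : 0 <= x -> 0 <= y -> B `<=` no_switch N x y ->
      fine (P B) <= expR (- (lambda * `|x - y|)).
    move=> x0 y0 Bxy; rewrite -(no_switch_prob poisson)//.
    have mB : measurable B by apply: measurableI; [apply: measurableI|]; exact: mns.
    apply: fine_le; rewrite ?fin_num_measure//; first exact: mns.
    by apply: le_measure => //; rewrite inE//; exact: mns.
  have [x [x0 Bx Dx]] : exists x, [/\ 0 <= x, B `<=` no_switch N s1 x & D <= `|s1 - x|].
    move: DM; rewrite !le_max => /orP[D2|/orP[D3|D4]].
    - by exists s2; split => // w [[]].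
    - by exists s3; split => // w [].
    - by exists s4; split => // w [[_ h34] h13]; rewrite /no_switch /= in h34 h13 *; congruence.
  apply: (le_trans (sub _ _ s10 x0 Bx)); rewrite ler_expR lerN2.
  by rewrite ler_wpM2l// ltW.
have /andP[b0 b1] := mixed_moment_itv driver i j.
move: PB => /andP[PB0 PB1].
set q := expR _ * expR _ in PA *.
have -> : m%:R^-1 ^+ 2 * fine (P A) + (mixed_moment P U i j - m%:R^-1 ^+ 2) * fine (P B)
   - m%:R^-1 ^+ 2 * q
  = m%:R^-1 ^+ 2 * (fine (P A) - q) + (mixed_moment P U i j - m%:R^-1 ^+ 2) * fine (P B) by ring.
apply: (le_trans (ler_normD _ _)).
have e0 : 0 <= e by rewrite expR_ge0.
rewrite (_ : 2 * e = 1 * e + 1 * e); last by ring.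
rewrite !normrM; apply: lerD.
  by apply: ler_pM => //; rewrite ger0_norm.
apply: ler_pM => //; last by rewrite ger0_norm.
by rewrite ler_norml; apply/andP; split; lra.
Qed.

End FourTimes.

(** * Geometric sums on a grid *)

Section GeometricSums.
Context (R : realType).

Definition natdist (a b : nat) : nat := (a - b + (b - a))%N.

Lemma natr_dist a b : `|a%:R - b%:R| = (natdist a b)%:R :> R.
Proof.
rewrite /natdist; case: (leqP a b) => ab.
  rewrite (_ : (a - b)%N = 0%N) ?add0n; last by apply/eqP; rewrite subn_eq0.
  by rewrite natrB// distrC ger0_norm// subr_ge0 ler_nat.
rewrite (_ : (b - a)%N = 0%N) ?addn0; last by apply/eqP; rewrite subn_eq0 ltnW.
by rewrite natrB; [rewrite ger0_norm// subr_ge0 ler_nat|]; exact: ltnW.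
Qed.

Lemma geometric_tail (p : R) K :
  (1 - p) * \sum_(0 <= b < K) p ^+ (K - b) = p * (1 - p ^+ K).
Proof.
elim: K => [|K IHK]; first by rewrite big_geq// expr0 subrr !mulr0.
rewrite big_nat_recr//= subSnn expr1.
rewrite (eq_big_nat _ _ (F2 := fun b => p * p ^+ (K - b))); last first.
  by move=> b /andP[_ bK]; rewrite subSn ?exprS// ltnW.
by rewrite -mulr_sumr mulrDr mulrCA IHK exprS; ring.
Qed.

Lemma geometric_head (p : R) K :
  (1 - p) * \sum_(0 <= b < K) p ^+ b = 1 - p ^+ K.
Proof.
elim: K => [|K IHK]; first by rewrite big_geq// expr0 subrr mulr0.
by rewrite big_nat_recr//= mulrDr IHK exprS; ring.
Qed.

Definition geometric_square (p : R) K : R :=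
  \sum_(0 <= a < K) \sum_(0 <= b < K) p ^+ natdist a b.

Lemma geometric_squareE (p : R) K :
  (1 - p) ^+ 2 * geometric_square p K
  = K%:R * (1 - p) * (1 + p) - 2 * p * (1 - p ^+ K).
Proof.
elim: K => [|K IHK].
  by rewrite /geometric_square big_geq// expr0 subrr !(mulr0, mul0r) subrr.
have side : \sum_(0 <= a < K) p ^+ natdist a K = \sum_(0 <= b < K) p ^+ (K - b).
  apply: eq_big_nat => a /andP[_ aK]; rewrite /natdist.
  by rewrite (_ : (a - K)%N = 0%N)//; apply/eqP; rewrite subn_eq0 ltnW.
have side' : \sum_(0 <= b < K) p ^+ natdist K b = \sum_(0 <= b < K) p ^+ (K - b).
  by rewrite -side; apply: eq_big_nat => a _; rewrite /natdist addnC.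
have -> : geometric_square p K.+1 =
    geometric_square p K + 2 * (\sum_(0 <= b < K) p ^+ (K - b)) + 1.
  rewrite /geometric_square big_nat_recr//=.
  under eq_bigr do rewrite big_nat_recr//=.
  rewrite big_split /= side big_nat_recr//= side'.
  by rewrite /natdist subnn expr0; ring.
rewrite 2!mulrDr IHK mulr1 expr2.
have -> : (1 - p) * (1 - p) * (2 * \sum_(0 <= b < K) p ^+ (K - b))
  = 2 * (1 - p) * ((1 - p) * \sum_(0 <= b < K) p ^+ (K - b)) by ring.
by rewrite geometric_tail -natr1 exprS; ring.
Qed.

Lemma geometric_row_le (p : R) a K : 0 <= p -> p < 1 ->
  \sum_(0 <= b < K) p ^+ natdist a b <= 2 / (1 - p).
Proof.
move=> p0 p1; have p1' : 0 < 1 - p by rewrite subr_gt0.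
rewrite ler_pdivlMr// mulrC.
apply: (@le_trans _ _ ((1 - p) * \sum_(0 <= b < a + K) p ^+ natdist a b)).
  rewrite ler_wpM2l ?(ltW p1')// [leRHS](big_cat_nat (n := K))//= ?leq_addl// lerDl.
  by apply: sumr_ge0 => b _; exact: exprn_ge0.
rewrite (big_cat_nat (n := a))//= ?leq_addr// mulrDr.
rewrite (eq_big_nat _ _ (F2 := fun b => p ^+ (a - b))); last first.
  move=> b /andP[_ ba]; rewrite /natdist (_ : (b - a)%N = 0%N) ?addn0//.
  by apply/eqP; rewrite subn_eq0 ltnW.
rewrite geometric_tail -{2}[a]add0n big_addn addKn.
rewrite (eq_bigr (fun b => p ^+ b)); last first.
  move=> b _; rewrite /natdist addnK (_ : (a - (b + a))%N = 0%N) ?add0n//.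
  by apply/eqP; rewrite subn_eq0 leq_addl.
rewrite geometric_head.
have := exprn_ge0 a p0; have := exprn_ge0 K p0 => h1 h2.
have : p * p ^+ a >= 0 by rewrite mulr_ge0.
by lra.
Qed.

(** From x / (1 + x) <= 1 - exp (- x) <= x: the sum of the geometric series of
    ratio exp (- lambda D), times the mesh D, is the mean holding time up to
    the mesh. *)
Lemma mesh_ratio (lambda D : R) : 0 < lambda -> 0 < D ->
  let y := D / (1 - expR (- (lambda * D))) in lambda^-1 <= y <= lambda^-1 + D.
Proof.
move=> l0 D0 /=; set y := D / _; have x0 : 0 < lambda * D by rewrite mulr_gt0.
set x := lambda * D in x0 *; set p := expR (- x).
have p1 : 0 < 1 - p by rewrite subr_gt0 -[ltRHS]expR0 ltr_expR oppr_lt0.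
have px : 1 - p <= x by have := expR_ge1Dx (- x); rewrite -/p; lra.
have xp : x <= (1 - p) * (1 + x).
  have ex : p * expR x = 1 by rewrite -expRD addNr expR0.
  have := expR_ge1Dx x; have p0 : 0 < p by exact: expR_gt0.
  by nra.
apply/andP; split.
  rewrite /y ler_pdivlMr// mulrC ler_pdivrMr//.
  by rewrite (mulrC D) -/x.
rewrite /y ler_pdivrMr//.
have -> : lambda^-1 + D = lambda^-1 * (1 + x) by rewrite /x; field; rewrite gt_eqF.
by rewrite -mulrA [leRHS]mulrC ler_pdivlMr// (mulrC D) -/x [leRHS]mulrC.
Qed.

(** The Riemann sum of exp (- lambda |u - v|) over the square of side t is
    2 t / lambda up to the boundary effect 2 / lambda^2. *)
Lemma geometric_square_mesh (lambda t : R) K : 0 < lambda -> 0 < t -> (0 < K)%N ->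
  let D := t / K%:R in
  `|D ^+ 2 * geometric_square (expR (- (lambda * D))) K - 2 * t / lambda|
  <= t * D + 2 * (lambda^-1 + D) ^+ 2.
Proof.
move=> l0 t0 K0 /=; set D := t / K%:R; have K0' : 0 < K%:R :> R by rewrite ltr0n.
have D0 : 0 < D by rewrite divr_gt0.
have tE : t = K%:R * D by rewrite /D mulrC divfK// gt_eqF.
set p := expR _; have p0 : 0 < p by exact: expR_gt0.
have p1 : 0 < 1 - p by rewrite subr_gt0 -[ltRHS]expR0 ltr_expR oppr_lt0 mulr_gt0.
have := mesh_ratio l0 D0; rewrite /= -/p; set y := D / (1 - p) => /andP[y1 y2].
have -> : D ^+ 2 * geometric_square p K
    = t * (2 * y - D) - 2 * p * (1 - p ^+ K) * y ^+ 2.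
  have yE : D = y * (1 - p) by rewrite /y divfK// gt_eqF.
  have -> : D ^+ 2 * geometric_square p K
     = y ^+ 2 * ((1 - p) ^+ 2 * geometric_square p K) by rewrite {1}yE; ring.
  by rewrite geometric_squareE tE [in RHS]yE; ring.
have pK : 0 <= p ^+ K <= 1.
  by rewrite exprn_ge0 ?(ltW p0)//= exprn_ile1// ltW// -subr_gt0.
have l0' : 0 < lambda^-1 by rewrite invr_gt0.
have y0 : 0 < y by apply: lt_le_trans y1.
have [A0 A1] : 0 <= 2 * p * (1 - p ^+ K) /\ 2 * p * (1 - p ^+ K) <= 2.
  by move: pK => /andP[? ?]; split; nra.
have B : 2 * p * (1 - p ^+ K) * y ^+ 2 <= 2 * (lambda^-1 + D) ^+ 2.
  by rewrite ler_pM// ?sqr_ge0// ler_sqr ?nnegrE// ltW// addr_gt0.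
have B0 : 0 <= 2 * p * (1 - p ^+ K) * y ^+ 2 by rewrite mulr_ge0 ?sqr_ge0.
have C1 : t * y <= t * (lambda^-1 + D) by rewrite ler_wpM2l// ltW.
have C2 : t * lambda^-1 <= t * y by rewrite ler_wpM2l// ltW.
have C3 : 0 <= (lambda^-1 + D) ^+ 2 by rewrite sqr_ge0.
by rewrite ler_norml; apply/andP; split; nra.
Qed.

End GeometricSums.

(** * Riemann sums of the path *)

Section Path.
Context (R : realType) d (T : measurableType d) (N : R -> T -> nat) (t : R) (w : T).
Hypothesis N_nd : forall s u : R, 0 <= s <= u -> (N s w <= N u w)%N.
Hypothesis N_rc : forall s : R, 0 <= s -> N u w @[u --> s^'+] --> N s w.
Hypothesis t_gt0 : 0 < t.

Let tau k := jump_time N k w.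

Lemma jump_time_itv k : (k <= N t w)%N -> 0 <= tau k <= t.
Proof.
move=> kt; rewrite /tau /jump_time; set S := [set s | _].
have St : S t by split => //; exact: ltW.
have lb0 : lbound S 0 by move=> s [].
apply/andP; split; first by apply: lb_le_inf => //; exists t.
by apply: ge_inf => //; exists 0.
Qed.

(** By right continuity the infimum defining a jump time is attained. *)
Lemma jump_timeP k s : (k <= N t w)%N -> 0 <= s -> (tau k <= s) = (k <= N s w)%N.
Proof.
move=> kt s0; rewrite /tau /jump_time; set S := [set s | _].
have St : S t by split => //; exact: ltW.
have lb0 : lbound S 0 by move=> u [].
have i0 : 0 <= inf S by apply: lb_le_inf => //; exists t.
apply/idP/idP => [si|ks]; last by apply: ge_inf; [exists 0|split].
have Si : (k <= N (inf S) w)%N.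
  rewrite leqNgt; apply/negP => ik.
  have : \forall u \near (inf S)^'+, N u w = N (inf S) w.
    have := N_rc i0; move=> /(_ [set N (inf S) w]); apply.
    exact: (@discrete_set1 nat).
  move=> [e /= e0 he].
  have [u [u0 ku] ue] : exists2 u, S u & u < inf S + e.
    by have [|u] := inf_adherent e0 (E := S); [split; [exists t|exists 0]|exists u].
  have iu : inf S <= u by apply: ge_inf; [exists 0|split].
  have : N u w = N (inf S) w.
    move: iu; rewrite le_eqVlt => /predU1P[<- //|iu].
    by apply: he => //=; rewrite ltr0_norm ?subr_lt0//; lra.
  by move=> uE; rewrite uE leqNgt ik in ku.
by apply: (leq_trans Si); apply: N_nd; rewrite i0.
Qed.

Lemma jump_time0 : tau 0 = 0.
Proof.
have /andP[h0 _] := jump_time_itv (leq0n _).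
by apply/le_anti; rewrite h0 andbT jump_timeP.
Qed.

(** The integral of s |-> u (N s) over [0, t], cut at the jump times. *)
Definition path_integral (u : nat -> R) : R :=
  \sum_(0 <= k < N t w) (tau k.+1 - tau k) * u k
  + (t - tau (N t w)) * u (N t w).

Lemma path_integral_by_parts (u : nat -> R) :
  path_integral u
  = t * u 0%N + \sum_(0 <= l < N t w) (u l.+1 - u l) * (t - tau l.+1).
Proof.
rewrite /path_integral; elim: (N t w) => [|J IHJ].
  by rewrite !big_geq// jump_time0; ring.
by rewrite !big_nat_recr//= addrA -IHJ; ring.
Qed.

(** Writing u (N s) as u 0 plus the increments u l.+1 - u l over the switches
    that occurred before s, the Riemann sum counts for each switch the grid
    points after it, and misses the remaining time by at most one mesh. *)
Lemma riemann_sum_error (u : nat -> R) (K : nat) : (0 < K)%N ->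
  let D := t / K%:R in
  `|D * \sum_(0 <= k < K) u (N (k%:R * D) w) - path_integral u|
  <= D * \sum_(0 <= l < N t w) `|u l.+1 - u l|.
Proof.
move=> K0 /=; set D := t / K%:R; have K0' : 0 < K%:R :> R by rewrite ltr0n.
have D0 : 0 < D by rewrite divr_gt0.
have tE : t = K%:R * D by rewrite /D mulrC divfK// gt_eqF.
have Nk k : (k < K)%N -> (N (k%:R * D) w <= N t w)%N.
  move=> kK; apply: N_nd; rewrite mulr_ge0 ?(ltW D0)//=.
  by rewrite [leRHS]tE ler_pM2r// ler_nat ltnW.
have telescope J n : (n <= J)%N ->
    u n = u 0%N + \sum_(0 <= l < J) (u l.+1 - u l) * (l.+1 <= n)%:R.
  move=> nJ; rewrite (big_cat_nat (n := n))//=.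
  rewrite [X in _ + (_ + X)]big1_seq; last first.
    by move=> l /andP[_]; rewrite mem_index_iota => /andP[nl _]; rewrite ltnNge nl mulr0.
  rewrite (eq_big_nat _ _ (F2 := fun l => u l.+1 - u l)); last first.
    by move=> l /andP[_ ln]; rewrite ln mulr1.
  by rewrite telescope_sumr// addr0; ring.
pose c l : R := \sum_(0 <= k < K) (l < N (k%:R * D) w)%N%:R.
have -> : D * \sum_(0 <= k < K) u (N (k%:R * D) w)
    = t * u 0%N + \sum_(0 <= l < N t w) (u l.+1 - u l) * (D * c l).
  rewrite (eq_big_nat _ _ (F2 := fun k => u 0%N +
     \sum_(0 <= l < N t w) (u l.+1 - u l) * (l < N (k%:R * D) w)%N%:R)); last first.
    by move=> k /andP[_ kK]; apply: telescope; exact: Nk.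
  rewrite big_split /= big_const_nat subn0 iter_addr_0 exchange_big /= mulrDr.
  congr (_ + _); first by rewrite [in RHS]tE -mulr_natr; ring.
  rewrite mulr_sumr; apply: eq_bigr => l _; rewrite -mulr_sumr -/(c l); ring.
rewrite path_integral_by_parts opprD addrACA subrr add0r -sumrB mulr_sumr.
apply: (le_trans (ler_norm_sum _ _ _)); apply: ler_sum_nat => l /andP[_ lJ].
rewrite -mulrBr normrM mulrC ler_wpM2r//.
have /andP[h0 ht] := jump_time_itv lJ.
have -> : c l = K%:R - \sum_(0 <= k < K) (k%:R < tau l.+1 / D)%R%:R.
  apply/eqP; rewrite eq_sym subr_eq; apply/eqP.
  rewrite /c -big_split /=.
  rewrite (eq_bigr (fun=> 1)); last first.
    move=> k _; rewrite ltr_pdivlMr// ltNge -/(tau _).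
    rewrite jump_timeP//; first by rewrite -natrD; case: (l < _)%N.
    by rewrite mulr_ge0// ltW.
  by rewrite big_const_nat subn0 iter_addr_0.
have := @count_below R K (tau l.+1 / D).
rewrite divr_ge0 ?(ltW D0)//= ler_pdivrMr// -tE ht => /(_ isT).
set S := \sum_(0 <= k < K) _ => hS.
have -> : D * (K%:R - S) - (t - tau l.+1) = - (D * (S - tau l.+1 / D)).
  by rewrite [in LHS]tE; field; rewrite gt_eqF.
by rewrite normrN normrM (gtr0_norm D0) -[leRHS]mulr1 ler_pM2l.
Qed.

Lemma riemann_sum_cvg (u : nat -> R) :
  (t / n.+1%:R * \sum_(0 <= k < n.+1) u (N (k%:R * (t / n.+1%:R)) w))
    @[n --> \oo] --> path_integral u.
Proof.
set S := \sum_(0 <= l < N t w) `|u l.+1 - u l|.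
apply: (@squeeze_cvgr _ _ _ _ (fun n => path_integral u - t * S * n.+1%:R^-1)
  (fun n => path_integral u + t * S * n.+1%:R^-1)).
- near=> n; have := @riemann_sum_error u n.+1 isT; rewrite /= -/S.
  rewrite ler_distl => /andP[h1 h2]; apply/andP; split.
    by rewrite (_ : t * S * n.+1%:R^-1 = t / n.+1%:R * S)//; ring.
  by rewrite (_ : t * S * n.+1%:R^-1 = t / n.+1%:R * S)//; ring.
- rewrite -[X in _ --> X]subr0; apply: cvgB; first exact: cvg_cst.
  rewrite -[X in _ --> X](mulr0 (t * S)); apply: cvgM; first exact: cvg_cst.
  exact: cvg_harmonic.
- rewrite -[X in _ --> X]addr0; apply: cvgD; first exact: cvg_cst.
  rewrite -[X in _ --> X](mulr0 (t * S)); apply: cvgM; first exact: cvg_cst.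
  exact: cvg_harmonic.
Unshelve. all: by end_near. Qed.

End Path.

(** * Fourth moments of the sampled path *)

Section SampledMoment.
Context (R : realType).

Lemma mulr_sum4 K (A B : nat -> nat -> R) :
  (\sum_(0 <= a < K) \sum_(0 <= b < K) A a b) *
  (\sum_(0 <= c < K) \sum_(0 <= e < K) B c e)
  = \sum_(0 <= a < K) \sum_(0 <= b < K) \sum_(0 <= c < K) \sum_(0 <= e < K)
      (A a b * B c e).
Proof.
rewrite mulr_suml; apply: eq_bigr => a _; rewrite mulr_suml.
apply: eq_bigr => b _; rewrite mulr_sumr; apply: eq_bigr => c _.
by rewrite mulr_sumr.
Qed.

(** For fixed a the sum factors into three sums over a row, so that only one of
    the four indices is free. *)
Lemma geometric_quadruple (r : R) K : 0 <= r -> r < 1 ->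
  \sum_(0 <= a < K) \sum_(0 <= b < K) \sum_(0 <= c < K) \sum_(0 <= e < K)
    (2 * (r ^+ natdist a b * r ^+ natdist a c * r ^+ natdist a e))
  <= 2 * K%:R * (2 / (1 - r)) ^+ 3.
Proof.
move=> r0 r1.
have -> : 2 * K%:R * (2 / (1 - r)) ^+ 3
    = \sum_(0 <= a < K) 2 * (2 / (1 - r)) ^+ 3 :> R.
  by rewrite big_const_nat subn0 iter_addr_0 -mulr_natr; ring.
apply: ler_sum => a _.
pose S := \sum_(0 <= b < K) r ^+ natdist a b.
have S0 : 0 <= S by apply: sumr_ge0 => b _; exact: exprn_ge0.
have -> : \sum_(0 <= b < K) \sum_(0 <= c < K) \sum_(0 <= e < K)
    (2 * (r ^+ natdist a b * r ^+ natdist a c * r ^+ natdist a e)) = 2 * S ^+ 3.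
  transitivity (\sum_(0 <= b < K) \sum_(0 <= c < K)
      (2 * (r ^+ natdist a b * r ^+ natdist a c) * S)).
    apply: eq_bigr => b _; apply: eq_bigr => c _.
    by rewrite mulr_sumr; apply: eq_bigr => e _; ring.
  transitivity (\sum_(0 <= b < K) (2 * r ^+ natdist a b * S ^+ 2)).
    apply: eq_bigr => b _; rewrite -mulr_suml.
    under eq_bigr do rewrite mulrA.
    by rewrite -mulr_sumr -/S; ring.
  by rewrite -mulr_suml -mulr_sumr -/S; ring.
rewrite ler_pM2l//; apply: lerXn2r; rewrite ?nnegrE//.
  by rewrite divr_ge0// subr_ge0 ltW.
exact: geometric_row_le.
Qed.

Context d (T : measurableType d) (P : probability T R).
Context m (lambda : R) (N : R -> T -> nat) (U : nat -> T -> m.-tuple R).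
Hypothesis driver : flight_driver P lambda N U.
Hypothesis lambda_gt0 : 0 < lambda.
Context (i j : 'I_m).
Hypothesis ij : i != j.
Variables (t : R) (K : nat).
Hypothesis t_gt0 : 0 < t.
Hypothesis K_gt0 : (0 < K)%N.

Let D : R := t / K%:R.
Let v k (a : nat) w := clipped_velocity N U k (a%:R * D) w.

(** The fourfold sum of the estimate four_times_decay over the grid. *)
Lemma sampled_moment :
  `|\int[P]_w ((D * \sum_(0 <= a < K) v i a w) ^+ 2 *
               (D * \sum_(0 <= a < K) v j a w) ^+ 2)
    - m%:R^-1 ^+ 2 *
      (D ^+ 2 * geometric_square (expR (- (lambda * D))) K) ^+ 2|
  <= 2 * t * (2 * (3 / lambda + D)) ^+ 3.
Proof.
have K0' : 0 < K%:R :> R by rewrite ltr0n.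
have D0 : 0 < D by rewrite divr_gt0.
have tE : t = K%:R * D by rewrite /D mulrC divfK// gt_eqF.
have s0 a : 0 <= a%:R * D by rewrite mulr_ge0// ltW.
have bv k a : bounded_measurable (v k a) by exact: (bounded_clipped_velocity driver).
have bvv k a b : bounded_measurable (fun w => v k a w * v k b w).
  exact: bounded_measurableM.
have bq a b c e : bounded_measurable (fun w => v i a w * v i b w * (v j c w * v j e w)).
  exact: bounded_measurableM.
pose q a b c e := \int[P]_w (v i a w * v i b w * (v j c w * v j e w)).
set p := expR (- (lambda * D)).
have -> : \int[P]_w ((D * \sum_(0 <= a < K) v i a w) ^+ 2 *
                     (D * \sum_(0 <= a < K) v j a w) ^+ 2)
  = D ^+ 4 * \sum_(0 <= a < K) \sum_(0 <= b < K) \sum_(0 <= c < K)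
               \sum_(0 <= e < K) q a b c e.
  transitivity (\int[P]_w (D ^+ 4 * \sum_(0 <= a < K) \sum_(0 <= b < K)
     \sum_(0 <= c < K) \sum_(0 <= e < K) (v i a w * v i b w * (v j c w * v j e w)))).
    apply: eq_Rintegral => w _.
    rewrite -(mulr_sum4 K (fun a b => v i a w * v i b w) (fun a b => v j a w * v j b w)).
    have sq k : \sum_(0 <= a < K) \sum_(0 <= b < K) v k a w * v k b w
              = (\sum_(0 <= a < K) v k a w) ^+ 2.
      by rewrite expr2 mulr_suml; apply: eq_bigr => a _; rewrite mulr_sumr.
    by rewrite !sq; ring.
  rewrite expectZ; last first.
    apply: bounded_measurable_sum => a; apply: bounded_measurable_sum => b.
    by apply: bounded_measurable_sum => c; exact: bounded_measurable_sum.
  congr (_ * _); rewrite expect_sum; last first.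
    move=> a; apply: bounded_measurable_sum => b.
    by apply: bounded_measurable_sum => c; exact: bounded_measurable_sum.
  apply: eq_bigr => a _; rewrite expect_sum; last first.
    by move=> b; apply: bounded_measurable_sum => c; exact: bounded_measurable_sum.
  apply: eq_bigr => b _; rewrite expect_sum; last by move=> c; exact: bounded_measurable_sum.
  by apply: eq_bigr => c _; rewrite expect_sum.
have -> : m%:R^-1 ^+ 2 * (D ^+ 2 * geometric_square p K) ^+ 2
  = D ^+ 4 * \sum_(0 <= a < K) \sum_(0 <= b < K) \sum_(0 <= c < K) \sum_(0 <= e < K)
      (m%:R^-1 ^+ 2 * (p ^+ natdist a b * p ^+ natdist c e)).
  rewrite exprMn [_ ^+ 2 ^+ 2]expr2 -[in RHS]mulrA -/(geometric_square p K).
  have -> : \sum_(0 <= a < K) \sum_(0 <= b < K) \sum_(0 <= c < K) \sum_(0 <= e < K)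
      (m%:R^-1 ^+ 2 * (p ^+ natdist a b * p ^+ natdist c e))
    = m%:R^-1 ^+ 2 * (geometric_square p K * geometric_square p K).
    rewrite /geometric_square mulr_sum4 mulr_sumr; apply: eq_bigr => a _.
    rewrite mulr_sumr; apply: eq_bigr => b _; rewrite mulr_sumr.
    by apply: eq_bigr => c _; rewrite mulr_sumr.
  by ring.
rewrite -mulrBr -sumrB normrM ger0_norm ?exprn_ge0 ?(ltW D0)//.
(* The spread of the four times is bounded below by the mean of the distances
   from the first one, so that the error bound splits into three factors. *)
set r := expR (- (lambda / 3 * D)).
have l3 : 0 < lambda / 3 by rewrite divr_gt0.
have r0 : 0 <= r by rewrite expR_ge0.
have r1 : r < 1 by rewrite -[ltRHS]expR0 ltr_expR oppr_lt0 mulr_gt0.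
have distE a b : `|a%:R * D - b%:R * D| = D * (natdist a b)%:R.
  by rewrite -mulrBl normrM natr_dist (gtr0_norm D0) mulrC.
have qe a b c e : `|q a b c e - m%:R^-1 ^+ 2 * (p ^+ natdist a b * p ^+ natdist c e)|
    <= 2 * (r ^+ natdist a b * r ^+ natdist a c * r ^+ natdist a e).
  have pE x y : p ^+ natdist x y = expR (- (lambda * `|x%:R * D - y%:R * D|)).
    by rewrite distE /p -expRM_natl; congr expR; ring.
  rewrite !pE.
  have -> : r ^+ natdist a b * r ^+ natdist a c * r ^+ natdist a e
    = expR (- (lambda * ((D * (natdist a b)%:R + D * (natdist a c)%:R
                          + D * (natdist a e)%:R) / 3))).
    by rewrite /r -!expRM_natl -!expRD; congr expR; field.
  apply: (four_times_decay driver lambda_gt0 ij) => //.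
  rewrite !distE !le_max.
  case: (lerP (D * (natdist a c)%:R) (D * (natdist a b)%:R)) => h1.
    case: (lerP (D * (natdist a e)%:R) (D * (natdist a b)%:R)) => h2.
      by apply/orP; left; lra.
    by apply/orP; right; apply/orP; right; lra.
  case: (lerP (D * (natdist a e)%:R) (D * (natdist a c)%:R)) => h2.
    by apply/orP; right; apply/orP; left; lra.
  by apply/orP; right; apply/orP; right; lra.
apply: (@le_trans _ _ (D ^+ 4 * (2 * K%:R * (2 / (1 - r)) ^+ 3))).
  rewrite ler_wpM2l ?exprn_ge0 ?(ltW D0)//.
  apply: le_trans (geometric_quadruple K r0 r1).
  apply: (le_trans (ler_norm_sum _ _ _)); apply: ler_sum => a _.
  rewrite -sumrB; apply: (le_trans (ler_norm_sum _ _ _)); apply: ler_sum => b _.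
  rewrite -sumrB; apply: (le_trans (ler_norm_sum _ _ _)); apply: ler_sum => c _.
  rewrite -sumrB; apply: (le_trans (ler_norm_sum _ _ _)); apply: ler_sum => e _.
  exact: qe.
have /andP[y1 y2] := mesh_ratio l3 D0; rewrite -/r in y1 y2.
have -> : D ^+ 4 * (2 * K%:R * (2 / (1 - r)) ^+ 3) = 2 * t * (2 * (D / (1 - r))) ^+ 3.
  by rewrite tE; ring.
have y0 : 0 <= D / (1 - r) by apply: le_trans y1; rewrite invr_ge0 ltW.
apply: ler_wpM2l; first by rewrite mulr_ge0// ltW.
have y3 : 0 <= 3 / lambda + D by rewrite addr_ge0 ?(ltW D0)// divr_ge0// ltW.
apply: lerXn2r; rewrite ?nnegrE; [exact: mulr_ge0|exact: mulr_ge0|].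
by rewrite ler_pM2l//; move: y2; rewrite invf_div.
Qed.

End SampledMoment.

(** * The fourth moment of the flight *)

Section FlightMoment.
Context d (T : measurableType d) (R : realType) (P : probability T R).
Context m (lambda : R) (N : R -> T -> nat) (U : nat -> T -> m.-tuple R).
Hypothesis driver : flight_driver P lambda N U.
Hypothesis lambda_gt0 : 0 < lambda.
Variable t : R.
Hypothesis t_gt0 : 0 < t.

Let poisson := flight_switching driver.

Lemma path_riemann_cvg (V : nat -> T -> R) w :
  (t / n.+1%:R * \sum_(0 <= k < n.+1) V (N (k%:R * (t / n.+1%:R)) w) w)
    @[n --> \oo] --> path_integral N t w (fun k => V k w).
Proof.
apply: (riemann_sum_cvg _ _ t_gt0 (u := fun k => V k w)).
- by move=> s u su; exact: (poisson_nondecreasing poisson).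
- by move=> s s0; exact: (poisson_right_continuous poisson).
Qed.

Lemma measurable_riemann_sum (V : nat -> T -> R) n :
  (forall k, measurable_fun setT (V k)) ->
  measurable_fun setT (fun w =>
    t / n.+1%:R * \sum_(0 <= k < n.+1) V (N (k%:R * (t / n.+1%:R)) w) w).
Proof.
move=> mV; apply: measurable_funM => //; apply: measurable_sum => k.
apply: (measurable_sampled driver) => //.
by rewrite mulr_ge0// divr_ge0// ltW.
Qed.

Lemma measurable_path_integral (V : nat -> T -> R) :
  (forall k, measurable_fun setT (V k)) ->
  measurable_fun setT (fun w => path_integral N t w (fun k => V k w)).
Proof.
move=> mV; apply: (measurable_fun_cvg (h := fun n w =>
    t / n.+1%:R * \sum_(0 <= k < n.+1) V (N (k%:R * (t / n.+1%:R)) w) w)).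
- by move=> n; exact: measurable_riemann_sum.
- by move=> w _; exact: path_riemann_cvg.
Qed.

Lemma flight_coordinate c (i : 'I_m) w :
  tnth (flight c N U t w) i
  = c * path_integral N t w (fun k => tnth (U k w) i).
Proof. by rewrite tnth_mktuple /path_integral [RHS]mulrDr mulrA. Qed.

Context (i j : 'I_m).

Let clipped_path (k : 'I_m) w :=
  path_integral N t w (fun n => clip (tnth (U n w) k)).

Definition path_moment : R :=
  \int[P]_w (clipped_path i w ^+ 2 * clipped_path j w ^+ 2).

Let measurable_clipped k n : measurable_fun setT (fun w => clip (tnth (U n w) k)).
Proof.
by have [] := bounded_clip_coordinate (flight_direction_measurable driver n) k.
Qed.

Let measurable_clipped_path k : measurable_fun setT (clipped_path k).
Proof. by apply: measurable_path_integral => n; exact: measurable_clipped. Qed.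

Let riemann k n w : R :=
  t / n.+1%:R * \sum_(0 <= a < n.+1)
    clipped_velocity N U k (a%:R * (t / n.+1%:R)) w.

Let riemann_cvg k w : riemann k n w @[n --> \oo] --> clipped_path k w.
Proof.
have := @path_riemann_cvg (fun n w => clip (tnth (U n w) k)) w.
exact.
Qed.

Let measurable_riemann k n : measurable_fun setT (riemann k n).
Proof.
apply: (measurable_riemann_sum (V := fun n w => clip (tnth (U n w) k))) => a.
exact: measurable_clipped.
Qed.

Let riemann_le k n w : `|riemann k n w| <= t.
Proof.
rewrite /riemann normrM gtr0_norm ?divr_gt0//.
rewrite [leRHS](_ : t = t / n.+1%:R * n.+1%:R); last by rewrite divfK// pnatr_eq0.
rewrite ler_pM2l ?divr_gt0//; apply: (le_trans (ler_norm_sum _ _ _)).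
rewrite [leRHS](_ : _ = \sum_(0 <= a < n.+1) 1); last first.
  by rewrite big_const_nat subn0 iter_addr_0.
by apply: ler_sum => a _; exact: clip_le1.
Qed.

(** A Riemann sum of clipped velocities is at most t, so convergence of the
    moments is dominated by t^4. *)
Lemma path_moment_cvg :
  P.-integrable setT (EFin \o (fun w => clipped_path i w ^+ 2 * clipped_path j w ^+ 2)) /\
  (\int[P]_w (riemann i n w ^+ 2 * riemann j n w ^+ 2)) @[n --> \oo] --> path_moment.
Proof.
have [] := @dominated_convergence _ T R P setT measurableT
  (fun n w => (riemann i n w ^+ 2 * riemann j n w ^+ 2)%:E)
  (fun w => (clipped_path i w ^+ 2 * clipped_path j w ^+ 2)%:E)
  (fun=> (t ^+ 2 * t ^+ 2)%:E).
- move=> n; apply/measurable_EFinP; apply: measurable_funM; apply: measurable_funX;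
    exact: measurable_riemann.
- apply/measurable_EFinP; apply: measurable_funM; apply: measurable_funX;
    exact: measurable_clipped_path.
- apply: aeW => w _; apply: cvg_EFin; first exact: nearW.
  by apply: cvgM; rewrite expr2; under eq_fun do rewrite expr2; apply: cvgM; exact: riemann_cvg.
- by apply: (@bounded_integrable _ T R P (fun=> t ^+ 2 * t ^+ 2)); exact: bounded_measurable_cst.
- apply: aeW => w n _; rewrite abse_EFin lee_fin normrM !normrX.
  by apply: ler_pM; rewrite ?exprn_ge0// lerXn2r ?nnegrE ?(ltW t_gt0).
move=> ip _ cp; split => //.
by rewrite /path_moment /Rintegral; apply: fine_cvg; rewrite fineK ?integrable_fin_num.
Qed.

Hypothesis ij : i != j.

(** Letting the mesh tend to zero in the sampled moments: 432 / lambda^3 is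
    2 (2 * 3 / lambda)^3, and 2 / lambda^2 is the limit of the boundary effect
    delta in the sum of exponentials. *)
Lemma path_moment_close :
  `|path_moment - m%:R^-1 ^+ 2 * (2 * t / lambda) ^+ 2|
  <= 432 * t / lambda ^+ 3
     + (2 / lambda ^+ 2) * (2 / lambda ^+ 2 + 4 * t / lambda).
Proof.
have [_ cvM] := path_moment_cvg.
pose D n : R := t * n.+1%:R^-1.
have cD : D n @[n --> \oo] --> (0 : R).
  rewrite -[X in _ --> X](mulr0 t); apply: cvgM; first exact: cvg_cst.
  exact: cvg_harmonic.
pose delta n := t * D n + 2 * ((lambda^-1 + D n) * (lambda^-1 + D n)).
have cdelta : delta n @[n --> \oo] --> t * 0 + 2 * ((lambda^-1 + 0) * (lambda^-1 + 0)).
  apply: cvgD; first by apply: cvgM => //; exact: cvg_cst.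
  apply: cvgM; first exact: cvg_cst.
  by apply: cvgM; apply: cvgD => //; exact: cvg_cst.
pose err n := 2 * (3 / lambda + D n).
have cerr : err n @[n --> \oo] --> 2 * (3 / lambda + 0).
  by apply: cvgM; [exact: cvg_cst|apply: cvgD => //; exact: cvg_cst].
pose x := 2 * t / lambda.
have x0 : 0 <= x by rewrite divr_ge0 ?mulr_ge0 ?(ltW t_gt0) ?(ltW lambda_gt0).
have cl : `|\int[P]_w (riemann i n w ^+ 2 * riemann j n w ^+ 2) - m%:R^-1 ^+ 2 * x ^+ 2|
    @[n --> \oo] --> `|path_moment - m%:R^-1 ^+ 2 * x ^+ 2|.
  by apply: cvg_norm; apply: cvgB; [exact: cvM|exact: cvg_cst].
have cr : 2 * t * (err n * (err n * err n)) + delta n * (delta n + 2 * x)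
    @[n --> \oo] --> 432 * t / lambda ^+ 3
     + (2 / lambda ^+ 2) * (2 / lambda ^+ 2 + 4 * t / lambda).
  have -> : 432 * t / lambda ^+ 3 + (2 / lambda ^+ 2) * (2 / lambda ^+ 2 + 4 * t / lambda)
   = 2 * t * (2 * (3 / lambda + 0) * (2 * (3 / lambda + 0) * (2 * (3 / lambda + 0))))
    + (t * 0 + 2 * ((lambda^-1 + 0) * (lambda^-1 + 0))) *
      (t * 0 + 2 * ((lambda^-1 + 0) * (lambda^-1 + 0)) + 2 * x).
    by rewrite /x; field; rewrite gt_eqF.
  apply: cvgD.
    apply: cvgM; first exact: cvg_cst.
    by apply: cvgM => //; exact: cvgM.
  by apply: cvgM => //; apply: cvgD => //; exact: cvg_cst.
apply: (ler_cvg_to cl cr).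
near=> n.
have h1 := @sampled_moment R d T P m lambda N U driver lambda_gt0 i j ij t n.+1 t_gt0 isT.
have h2 := @geometric_square_mesh R lambda t n.+1 lambda_gt0 t_gt0 isT.
rewrite /= -/(D n) -/x in h1 h2.
set y := D n ^+ 2 * _ in h1 h2.
have -> : \int[P]_w (riemann i n w ^+ 2 * riemann j n w ^+ 2) - m%:R^-1 ^+ 2 * x ^+ 2
  = (\int[P]_w (riemann i n w ^+ 2 * riemann j n w ^+ 2) - m%:R^-1 ^+ 2 * y ^+ 2)
   + m%:R^-1 ^+ 2 * ((y - x) * ((y - x) + 2 * x)) by ring.
apply: (le_trans (ler_normD _ _)); apply: lerD.
  by apply: (le_trans h1); rewrite /err le_eqVlt; apply/orP; left; apply/eqP; ring.
have m0 : (0 < m)%N by apply: leq_ltn_trans (ltn_ord i).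
have sq0 : 0 <= m%:R^-1 ^+ 2 :> R by rewrite sqr_ge0.
have sq1 : m%:R^-1 ^+ 2 <= 1 :> R by rewrite expr_le1// invf_le1 ?ltr0n// ler1n.
rewrite normrM (ger0_norm sq0) -[leRHS]mul1r; apply: ler_pM => //.
rewrite normrM; apply: ler_pM => //; rewrite /delta -expr2.
by apply: (le_trans (ler_normD _ _)); rewrite (ger0_norm (mulr_ge0 _ x0))// lerD2r.
Unshelve. all: by end_near. Qed.

(** Almost surely no direction is affected by clipping. *)
Lemma expectation_flight c :
  ('E_P[fun w => (tnth (flight c N U t w) i ^+ 2 * tnth (flight c N U t w) j ^+ 2)%R])%E
  = (c ^+ 4 * path_moment)%:E.
Proof.
have [ip _] := path_moment_cvg.
rewrite unlock EFinM /path_moment /Rintegral fineK; last exact: integrable_fin_num.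
rewrite -integralZl//.
have mcoord k n : measurable_fun setT (fun w => tnth (U n w) k).
  apply: (measurableT_comp (f := fun y : m.-tuple R => tnth y k)).
    exact: measurable_tnth.
  exact: (flight_direction_measurable driver).
have mflight k : measurable_fun setT (fun w => tnth (flight c N U t w) k).
  rewrite (_ : (fun w => _) = fun w => c * path_integral N t w (fun n => tnth (U n w) k)).
    by apply: measurable_funM => //; exact: measurable_path_integral.
  by apply/funext => w; rewrite flight_coordinate.
apply: ae_eq_integral => //.
- apply/measurable_EFinP; apply: measurable_funM; exact: measurable_funX.
- apply: measurable_funeM.
  apply/measurable_EFinP; apply: measurable_funM; apply: measurable_funX;
    exact: measurable_clipped_path.
have Ule n : {ae P, forall w k, `|tnth (U n w) k| <= 1}.
  apply: uniform_coordinate_le1; first exact: (flight_direction_measurable driver).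
  exact: (flight_direction_uniform driver).
have := (ae_foralln Ule).
apply: filterS => w Uw _; rewrite !flight_coordinate -EFinM; congr EFin.
have e k : path_integral N t w (fun n => tnth (U n w) k) = clipped_path k w.
  by rewrite /clipped_path; congr path_integral; apply/funext => n; rewrite clip_id.
by rewrite !e; ring.
Qed.

End FlightMoment.

(** * Variance of a centred normal law *)

Section NormalVariance.
Context (R : realType) (s : R).
Hypothesis s_gt0 : 0 < s.
Notation mu := (@lebesgue_measure R).

Let p : R -> R := normal_pdf 0 s.

Let s_neq0 : s != 0. Proof. by rewrite gt_eqF. Qed.

Let pE x : p x = normal_peak s * expR (- (x ^+ 2 / (s ^+ 2 *+ 2))).
Proof. by rewrite /p normal_pdfE// /normal_fun subr0 mulNr. Qed.

Let p_ge0 x : 0 <= p x. Proof. exact: normal_pdf_ge0. Qed.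

Let p_continuous : continuous p. Proof. exact: continuous_normal_pdf. Qed.

Let measurable_p : measurable_fun setT p. Proof. exact: measurable_normal_pdf. Qed.

Let p_even : p =1 p \o -%R.
Proof. by move=> x; rewrite /= !pE sqrrN. Qed.

Let is_derive_p (x : R) : is_derive x (1 : R) p (- (x / s ^+ 2) * p x).
Proof.
have -> : p = fun x => normal_peak s * expR (- (x ^+ 2 / (s ^+ 2 *+ 2))).
  by apply/funext => y; rewrite pE.
have dq : is_derive x (1 : R) (fun x : R => - (x ^+ 2 / (s ^+ 2 *+ 2))) (- (x / s ^+ 2)).
  rewrite (_ : (fun x : R => _) = (fun x : R => (- (s ^+ 2 *+ 2)^-1) *: (x ^+ 2 : R))); last first.
    by apply/funext => y; rewrite /GRing.scale /= mulNr mulrC.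
  apply: is_derive_eq; rewrite /GRing.scale /=.
  by field.
have de := @is_derive1_comp R expR _ x _ _ (is_derive_expR _) dq.
have h := @is_deriveZ _ _ _ _ (normal_peak s) _ _ _ de. apply: (@is_derive_eq _ _ _ _ _ _ _ _ h).
by rewrite /GRing.scale /=; ring.
Qed.

(** Integration by parts of x against x p x, whose antiderivative is
    - s^2 p x. *)
Let truncated_second_moment n : (0 < n)%N ->
  (\int[mu]_(x in `[0%R, n%:R]) (x ^+ 2 * p x)%:E
   = (s ^+ 2)%:E * \int[mu]_(x in `[0%R, n%:R]) (p x)%:E
     + (- (s ^+ 2 * (n%:R * p n%:R)))%:E)%E.
Proof.
move=> n0.
have ip : mu.-integrable `[0%R, n%:R] (EFin \o p).
  by apply: (integrableS measurableT) => //; exact: integrable_normal_pdf.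
have cG : continuous (fun x => - s ^+ 2 * p x).
  by move=> x; apply: cvgM; [exact: cvg_cst|exact: p_continuous].
have dG (x : R) : is_derive x (1 : R) (fun x => - s ^+ 2 * p x) (x * p x).
  have h := @is_deriveZ _ _ _ _ (- s ^+ 2) _ _ _ (is_derive_p x).
  apply: (@is_derive_eq _ _ _ _ _ _ _ _ h).
  by rewrite /GRing.scale /=; field.
have LR (F : R -> R) : continuous F -> (forall x, derivable F x 1) ->
    derivable_oo_LRcontinuous F 0 n%:R.
  move=> cF dF; split; first by move=> x _; exact: dF.
    by apply: cvg_at_right_filter; exact: cF.
  by apply: cvg_at_left_filter; exact: cF.
have cx (f : R -> R) : continuous f -> {within `[0%R, n%:R], continuous f}.
  by move=> cf; exact: continuous_subspaceT.
have := @integration_by_parts R id (fun x : R => - s ^+ 2 * p x)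
  (fun _ : R => 1 : R) (fun x : R => x * p x) 0 n%:R.
rewrite ltr0n n0 => /(_ isT).
have c1 : {within `[0%R, n%:R], continuous (fun _ : R => 1 : R)}.
  by apply: cx => x; exact: cvg_cst.
have LRid : derivable_oo_LRcontinuous (@id R) 0 n%:R.
  by apply: LR => [x|x]; [exact: cvg_id|exact: derivable_id].
have did : {in `]0%R, n%:R[, (@id R)^`()%classic =1 fun _ : R => 1 : R}.
  by move=> x _; rewrite derive1E derive_id.
have cg : {within `[0%R, n%:R], continuous (fun x : R => x * p x)}.
  by apply: cx => x; apply: cvgM; [exact: cvg_id|exact: p_continuous].
have LRG : derivable_oo_LRcontinuous (fun x : R => - s ^+ 2 * p x) 0 n%:R.
  by apply: LR => // x; have [] := dG x.
have dG' : {in `]0%R, n%:R[, (fun x : R => - s ^+ 2 * p x)^`()%classic =1 fun x : R => x * p x}.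
  by move=> x _; rewrite derive1E; have [_ ->] := dG x.
move=> /(_ c1 LRid did cg LRG dG').
under eq_integral do rewrite mulrA -expr2.
move=> ->.
under eq_integral do rewrite mul1r EFinM.
rewrite integralZl//= mul0r subr0 addeC; congr (_ + _)%E.
  by rewrite EFinN mulNe oppeK.
by congr EFin; ring.
Qed.

Let tail_cvg : n.+1%:R * p n.+1%:R @[n --> \oo] --> (0 : R).
Proof.
have pk : 0 < normal_peak s by exact: normal_peak_gt0.
apply: (@squeeze_cvgr _ _ _ _ (fun=> 0)
  (fun n => (normal_peak s * (s ^+ 2 *+ 2)) * n.+1%:R^-1)).
- near=> n; rewrite mulr_ge0//= pE.
  set x : R := n.+1%:R; have x0 : 0 < x by rewrite ltr0n.
  set a := s ^+ 2 *+ 2; have a0 : 0 < a by rewrite pmulrn_lgt0// exprn_gt0.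
  rewrite -mulrA mulrCA ler_pM2l// expRN ler_pdivlMr// mulrAC.
  rewrite ler_pdivrMr ?expR_gt0//.
  have h := expR_ge1Dx (x ^+ 2 / a).
  apply: (@le_trans _ _ (a * (x ^+ 2 / a))).
    by rewrite mulrCA divff ?gt_eqF// mulr1 expr2.
  by rewrite ler_pM2l//; lra.
- exact: cvg_cst.
- rewrite -[X in _ --> X](mulr0 (normal_peak s * (s ^+ 2 *+ 2))).
  by apply: cvgM; [exact: cvg_cst|exact: cvg_harmonic].
Unshelve. all: by end_near. Qed.

Let half_line (f : R -> R) : (forall x, 0 <= f x) -> continuous f ->
  f =1 f \o -%R ->
  (\int[mu]_x (f x)%:E = 2%:E * \int[mu]_(x in `[0%R, +oo[) (f x)%:E)%E.
Proof.
move=> f0 cf ef; rewrite ge0_symfun_integralT//; congr (_ * integral _ _ _)%E.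
by apply/seteqP; split => x /=; rewrite in_itv /= andbT.
Qed.

Lemma normal_second_moment : (\int[mu]_x (x ^+ 2 * p x)%:E = (s ^+ 2)%:E)%E.
Proof.
have x2p0 x : 0 <= x ^+ 2 * p x by rewrite mulr_ge0 ?sqr_ge0.
have cx2p : continuous (fun x : R => x ^+ 2 * p x).
  by move=> x; apply: cvgM; [exact: exprn_continuous|exact: p_continuous].
rewrite half_line//; last by move=> x; rewrite /= sqrrN p_even.
have half : (\int[mu]_(x in `[0%R, +oo[) (p x)%:E = (2^-1)%:E)%E.
  have := @integral_normal_pdf R 0 s; rewrite half_line// -/p.
  case: (\int[mu]_(x in _) _)%E => [r| |] //=.
    by rewrite -EFinM => -[] r2; congr EFin; lra.
  by rewrite gt0_muley.
  by rewrite gt0_muleNy.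
have c1 := @ge0_cvgn_integral R mu _ x2p0 (continuous_measurable_fun cx2p).
have c2 := @ge0_cvgn_integral R mu _ p_ge0 measurable_p.
have c3 : (\int[mu]_(x in `[0%R, n%:R]) (x ^+ 2 * p x)%:E)%E @[n --> \oo]
    --> ((s ^+ 2)%:E * (2^-1)%:E + (- (s ^+ 2 * 0))%:E)%E.
  rewrite -cvg_shiftS /=.
  under eq_cvg do rewrite truncated_second_moment//.
  have cA : ((s ^+ 2)%:E * \int[mu]_(x in `[0%R, n.+1%:R]) (p x)%:E)%E @[n --> \oo]
      --> ((s ^+ 2)%:E * (2^-1)%:E)%E.
    apply: cvgeZl => //; rewrite -half.
    by rewrite -cvg_shiftS in c2.
  have cB : (- (s ^+ 2 * (n.+1%:R * p n.+1%:R)))%:E @[n --> \oo]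
      --> (- (s ^+ 2 * 0))%:E.
    apply: cvg_EFin; first exact: nearW.
    by apply: cvgN; apply: cvgM; [exact: cvg_cst|exact: tail_cvg].
  exact: (cvgeD _ cA cB).
have := cvg_unique _ c1 c3 => ->//.
by rewrite mulr0 oppr0 adde0 -!EFinM; congr EFin; field.
Qed.

End NormalVariance.

Section NormalVariable.
Context d (T : measurableType d) (R : realType) (P : probability T R) (s : R).
Hypothesis s_gt0 : 0 < s.
Notation mu := (@lebesgue_measure R).

Let measurable_pdf : measurable_fun setT (EFin \o normal_pdf 0 s).
Proof. by apply/measurable_EFinP; exact: measurable_normal_pdf. Qed.

(** The density is the Radon-Nikodym derivative, up to a null set. *)
Lemma ge0_integral_normal_prob (f : R -> \bar R) :
  measurable_fun setT f -> (forall x, 0 <= f x)%E ->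
  (\int[normal_prob 0 s]_x f x = \int[mu]_x (f x * (normal_pdf 0 s x)%:E))%E.
Proof.
move=> mf f0; have dom := @normal_prob_dominates R 0 s.
pose nu : {finite_measure set (measurableTypeR R) -> \bar R} := normal_prob 0 s.
rewrite -(@Radon_Nikodym_SigmaFinite.change_of_variables _ _ _ nu mu dom f setT f0 measurableT mf).
have mg := measurable_int _ (Radon_Nikodym_SigmaFinite.f_integrable dom : mu.-integrable setT _).
apply: ae_eq_integral => //.
- exact: emeasurable_funM.
- exact: emeasurable_funM.
- apply: ae_eqe_mul2l; apply: integral_ae_eq => //.
    exact: Radon_Nikodym_SigmaFinite.f_integrable.
  by move=> E _ mE; rewrite -(Radon_Nikodym_SigmaFinite.f_integral dom).
Qed.

Lemma normal_prob_opp (A : set R) : measurable A ->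
  normal_prob 0 s ((-%R : R -> R) @^-1` A) = normal_prob 0 s A.
Proof.
move=> mA; rewrite /normal_prob.
transitivity (\int[pushforward mu (-%R : measurableTypeR R -> measurableTypeR R)]_(x in A)
   (normal_pdf 0 s x)%:E)%E.
  rewrite ge0_integral_pushforward//; last 2 first.
  - exact: measurable_funTS.
  - by move=> x _; rewrite lee_fin normal_pdf_ge0.
  apply: eq_integral => x _; rewrite /= !normal_pdfE ?gt_eqF//.
  by rewrite /normal_fun !subr0 sqrrN.
by apply: eq_measure_integral => // B mB _; exact: lebesgue_measureN.
Qed.

Lemma variance_normal (X : T -> R) : measurable_fun setT X ->
  (forall A, measurable A -> P (X @^-1` A) = normal_prob 0 s A) ->
  'V_P[X] = (s ^+ 2)%:E.
Proof.
move=> mX X_law.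
have mNX : measurable_fun setT (\- X) by exact: measurable_funN.
have msq : measurable_fun setT (fun x : R => (x ^+ 2)%:E).
  by apply/measurable_EFinP; exact: exprn_measurable.
have EX2 : (\int[P]_w (X w ^+ 2)%:E = (s ^+ 2)%:E)%E.
  transitivity (\int[pushforward P (X : T -> measurableTypeR R)]_x (x ^+ 2)%:E)%E.
    rewrite ge0_integral_pushforward//.
    by move=> x _; rewrite lee_fin sqr_ge0.
  transitivity (\int[normal_prob 0 s]_x (x ^+ 2)%:E)%E.
    by apply: eq_measure_integral => A mA _; exact: X_law.
  rewrite ge0_integral_normal_prob//; last by move=> x; rewrite lee_fin sqr_ge0.
  by rewrite -(normal_second_moment s_gt0); apply: eq_integral => x _.
have iX : P.-integrable setT (EFin \o X).
  apply/integrableP; split; first exact/measurable_EFinP.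
  apply: (@le_lt_trans _ _ (\int[P]_w (1 + X w ^+ 2)%:E)%E).
    apply: ge0_le_integral => //.
    - by apply: measurableT_comp => //; exact/measurable_EFinP.
    - by apply/measurable_EFinP; apply: measurable_funD => //; exact: measurable_funX.
    - move=> w _; rewrite /= lee_fin -[X w ^+ 2]real_normK ?num_real//.
      have : 0 <= (`|X w| - 1) ^+ 2 by rewrite sqr_ge0.
      by have := normr_ge0 (X w); nra.
  under eq_integral do rewrite EFinD.
  rewrite ge0_integralD//; last 2 first.
  - by move=> w _; rewrite lee_fin sqr_ge0.
  - by apply/measurable_EFinP; exact: measurable_funX.
  by rewrite EX2 integral_cst//= probability_setT mule1 -EFinD ltry.
have EX : (\int[P]_w (X w)%:E = 0)%E.
  have law_int Y : measurable_fun setT Y -> P.-integrable setT (EFin \o Y) ->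
      (forall A, measurable A -> P (Y @^-1` A) = normal_prob 0 s A) ->
      (\int[P]_w (Y w)%:E = \int[normal_prob 0 s]_x x%:E)%E.
    move=> mY iY Ylaw; transitivity (\int[pushforward P (Y : T -> measurableTypeR R)]_x x%:E)%E.
      exact/esym/(@integral_pushforward _ _ T (measurableTypeR R) R Y mY P setT EFin).
    by apply: eq_measure_integral => A mA _; exact: Ylaw.
  have iNX : P.-integrable setT (EFin \o (\- X)).
    by apply: eq_integrable (integrableN iX) => // w _.
  have NX_law A : measurable A -> P ((\- X) @^-1` A) = normal_prob 0 s A.
    move=> mA; rewrite -normal_prob_opp//.
    rewrite -X_law// -[X in measurable X]setTI.
    exact: (oppr_measurable measurableT).
  have := law_int _ mNX iNX NX_law; rewrite -(law_int _ mX iX X_law).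
  under eq_integral do rewrite EFinN.
  rewrite integralN/=; last by rewrite integrable_add_def.
  have : (\int[P]_w (X w)%:E)%E \is a fin_num by exact: integrable_fin_num iX.
  case: (\int[P]_w (X w)%:E)%E => // r _ [] h.
  by congr EFin; lra.
rewrite /variance unlock [in fine _]unlock EX /= unlock -EX2.
by apply: eq_integral => w _; rewrite /= /GRing.mul /= subr0 -expr2.
Qed.

End NormalVariable.

(** * The Kac limit *)

Section KacLimit.
Context (R : realType) (m : nat) (rho t : R).

(** Multiplied by c^4, the error of path_moment_close is (c^2 / lambda)^2 times
    a polynomial in 1 / lambda without constant term. *)
Lemma kac_limit (c lambda M : nat -> R) :
  (forall n, 0 < lambda n) -> lambda n @[n --> \oo] --> +oo ->
  c n ^+ 2 / lambda n @[n --> \oo] --> rho ->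
  (forall n, `|M n - m%:R^-1 ^+ 2 * (2 * t / lambda n) ^+ 2|
     <= 432 * t / lambda n ^+ 3
     + (2 / lambda n ^+ 2) * (2 / lambda n ^+ 2 + 4 * t / lambda n)) ->
  c n ^+ 4 * M n @[n --> \oo] --> (2 * rho * t / m%:R) ^+ 2.
Proof.
move=> l0 ly crho Mle.
pose e n := (lambda n)^-1; pose r n := c n ^+ 2 / lambda n.
have ce : e n @[n --> \oo] --> (0 : R).
  by apply/(gtr0_cvgV0 (f := lambda)) => //; exact: nearW.
pose a n := m%:R^-1 * (2 * t) * r n * (m%:R^-1 * (2 * t) * r n).
pose b n := r n * r n * (432 * t * e n + 2 * (2 * (e n * e n) + 4 * t * e n)).
have ca : a n @[n --> \oo] --> (2 * rho * t / m%:R) ^+ 2.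
  rewrite (_ : (2 * rho * t / m%:R) ^+ 2 =
    m%:R^-1 * (2 * t) * rho * (m%:R^-1 * (2 * t) * rho)); last by ring.
  by apply: cvgM; apply: cvgM => //; exact: cvg_cst.
have cb : b n @[n --> \oo] --> (0 : R).
  rewrite (_ : 0 = rho * rho * (432 * t * 0 + 2 * (2 * (0 * 0) + 4 * t * 0))); last by ring.
  apply: cvgM; first exact: cvgM.
  apply: cvgD; first by apply: cvgM => //; exact: cvg_cst.
  apply: cvgM; first exact: cvg_cst.
  apply: cvgD; first by apply: cvgM; [exact: cvg_cst|exact: cvgM].
  by apply: cvgM => //; exact: cvg_cst.
apply: (@squeeze_cvgr _ _ _ _ (fun n => a n - b n) (fun n => a n + b n)).
- near=> n; rewrite -ler_distl.
  have ln : lambda n != 0 by rewrite gt_eqF.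
  have -> : a n = c n ^+ 4 * (m%:R^-1 ^+ 2 * (2 * t / lambda n) ^+ 2).
    by rewrite /a /r; ring.
  have -> : b n = c n ^+ 4 * (432 * t / lambda n ^+ 3
     + (2 / lambda n ^+ 2) * (2 / lambda n ^+ 2 + 4 * t / lambda n)).
    by rewrite /b /r /e; field.
  have c0 : 0 <= c n ^+ 4 by rewrite exprn_even_ge0.
  by rewrite -mulrBr normrM (ger0_norm c0) ler_wpM2l.
- by rewrite -[X in _ --> X]subr0; exact: cvgB.
- by rewrite -[X in _ --> X]addr0; exact: cvgD.
Unshelve. all: by end_near. Qed.

End KacLimit.

Theorem mainTheorem2 (R : realType) (m : nat) (rho t : R)
    (m_ge3 : (3 <= m)%N) (rho_gt0 : 0 < rho) (t_gt0 : 0 < t) :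
  (forall (c lambda : nat -> R)
     (d : nat -> measure_display) (T : forall n, measurableType (d n))
     (P : forall n, probability (T n) R)
     (N : forall n, R -> T n -> nat)
     (U : forall n, nat -> T n -> m.-tuple R),
     (forall n, 0 < c n) -> (forall n, 0 < lambda n) ->
     (forall n, flight_driver (P n) (lambda n) (N n) (U n)) ->
     c n @[n --> \oo] --> +oo ->
     lambda n @[n --> \oo] --> +oo ->
     c n ^+ 2 / lambda n @[n --> \oo] --> rho ->
     ('E_(P n)[fun w => ((flight (c n) (N n) (U n) t w)`_0 ^+ 2
                        * (flight (c n) (N n) (U n) t w)`_1 ^+ 2)%R])%E
       @[n --> \oo] --> ((2 * rho * t / m%:R) ^+ 2)%:E)
  /\
  (forall (d : measure_display) (T : measurableType d) (P : probability T R)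
     (B : R -> T -> m.-tuple R),
     brownian_motion P (2 * rho / m%:R) B ->
     (forall i, 'V_P[fun w => tnth (B t w) i] = (2 * rho / m%:R * t)%:E) /\
     (forall i j, i != j ->
        ((2 * rho * t / m%:R) ^+ 2)%:E
        = ('V_P[fun w => tnth (B t w) i] * 'V_P[fun w => tnth (B t w) j])%E)).
Proof.
have m_gt0 : (0 < m)%N by exact: leq_trans m_ge3.
split.
  move=> c lambda d T P N U _ lambda_gt0 driver _ lambda_oo crho.
  have m1 : (1 < m)%N by exact: leq_trans m_ge3.
  pose i := Ordinal m_gt0; pose j := Ordinal m1.
  have ij : i != j by [].
  pose M n := path_moment (P n) (N n) (U n) t i j.
  have EM n : ('E_(P n)[fun w => ((flight (c n) (N n) (U n) t w)`_0 ^+ 2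
      * (flight (c n) (N n) (U n) t w)`_1 ^+ 2)%R])%E = (c n ^+ 4 * M n)%:E.
    rewrite -(expectation_flight (driver n) t_gt0 i j).
    by congr expectation; apply/funext => w; rewrite !(tnth_nth 0).
  under eq_cvg do rewrite EM.
  apply: cvg_EFin; first exact: nearW.
  apply: (kac_limit lambda_gt0 lambda_oo crho) => n.
  exact: (path_moment_close (driver n) (lambda_gt0 n) t_gt0 ij).
move=> d T P B bm.
have V i : 'V_P[fun w => tnth (B t w) i] = (2 * rho / m%:R * t)%:E.
  have s2 : 0 < 2 * rho / m%:R * t.
    by rewrite mulr_gt0// divr_gt0 ?mulr_gt0 ?ltr0n.
  have s_gt0 : 0 < Num.sqrt (2 * rho / m%:R * t) by rewrite sqrtr_gt0.
  rewrite -[in RHS](sqr_sqrtr (ltW s2)); apply: (variance_normal s_gt0).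
    apply: (measurableT_comp (f := fun y : m.-tuple R => tnth y i)).
      exact: measurable_tnth.
    by apply: (brownian_measurable bm); exact: ltW.
  move=> A mA; have := brownian_increments bm (s := 0) (t := t) _ i mA.
  rewrite subr0 lexx t_gt0 => <- //.
  by congr (P _); apply/funext => w /=; rewrite (brownian_start bm) subr0.
split=> // i j _; rewrite !V -EFinM; congr EFin.
by field; rewrite pnatr_eq0 -lt0n.
Qed.
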